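(* Let $f:\Omega\to\mathbb{R}$ be a continuous potential satisfying the weak Walters condition, and consider $\mathscr{L}_f:C(\Omega)\to C(\Omega)$. Then there exist a real number $\lambda_f>0$, a strictly positive continuous function $h_f$, and a unique Borel probability measure $\nu_f$ such that (i) $\mathscr{L}_fh_f=\lambda_fh_f$ and $\mathscr{L}_f^*\nu_f=\lambda_f\nu_f$; (ii) for every $\varphi\in C(\Omega)$, $\big\|\lambda_f^{-n}\mathscr{L}_f^n\varphi-h_f\int_\Omega\varphi\,d\nu_f\big\|_0\to0$ as $n\to\infty$.
   Context: $(M,d)$ is a compact metric space and $\mu$ is a Borel probability measure on $M$ with $\operatorname{supp}\mu=M$. $\Omega=M^{\mathbb{N}}$ with metric $d_\Omega(x,y)=\sum_{n\ge1}2^{-n}d(x_n,y_n)$, $\sigma$ the left shift, $ax=(a,x_1,\dots)$ and $\mathbf{a}x=(a_1,\dots,a_n,x_1,\dots)$ for $\mathbf{a}\in M^n$. The Ruelle operator is $\mathscr{L}_f(\varphi)(x)=\int_M e^{f(ax)}\varphi(ax)\,d\mu(a)$ and $\mathscr{L}_f^*$ is its dual on Borel measures. $\|\cdot\|_0$ is the sup norm. $S_nf=\sum_{i=0}^{n-1}f\circ\sigma^i$; $C_f(x,y)=\sup_{n\ge1}\sup_{\mathbf{a}\in M^n}(S_nf(\mathbf{a}x)-S_nf(\mathbf{a}y))$; $f$ satisfies the weak Walters condition if $C_f(x,y)\to0$ as $d_\Omega(x,y)\to0$. *)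

(* Defs.v *)
From HB Require Import structures.
From mathcomp Require Import all_boot all_order all_algebra.
From mathcomp Require Import all_classical all_reals all_analysis.
Set Implicit Arguments. Unset Strict Implicit. Unset Printing Implicit Defensive.
Import Order.TTheory GRing.Theory Num.Theory.
Import numFieldNormedType.Exports.
Local Open Scope classical_set_scope.
Local Open Scope ring_scope.

Section Defs.
Variables (R : realType) (M : pointedType).

Definition is_metric (d : M -> M -> R) : Prop :=
  [/\ forall x y, 0 <= d x y,
      forall x y, d x y = 0 <-> x = y,
      forall x y, d x y = d y x &
      forall x y z, d x z <= d x y + d y z].

Definition mopen {T : Type} (dT : T -> T -> R) (U : set T) : Prop :=
  forall x, U x -> exists2 r : R, 0 < r & forall y, dT x y < r -> U y.

Definition mcompact (d : M -> M -> R) : Prop :=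
  forall (I : Type) (U : I -> set M),
    (forall i, mopen d (U i)) -> (forall x, exists i, U i x) ->
    exists (n : nat) (g : 'I_n -> I), forall x, exists k, U (g k) x.

Definition mcontinuous {T : Type} (dT : T -> T -> R) (g : T -> R) : Prop :=
  forall x (e : R), 0 < e -> exists2 del : R, 0 < del &
    forall y, dT x y < del -> `|g x - g y| < e.

(* Omega = M^N (indexed from 0 here), d_Omega(x,y) = sum_{n>=0} 2^{-(n+1)} d(x_n,y_n) *)
Definition dOmega (d : M -> M -> R) (x y : nat -> M) : R :=
  limn (fun N : nat => \sum_(0 <= n < N) ((2 ^- n.+1) * d (x n) (y n))).

Definition pcons (a : M) (x : nat -> M) : nat -> M :=
  fun k => if k is k'.+1 then x k' else a.

(* (a_1..a_n) x ; the word is given by the first n values of w *)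
Definition pword (n : nat) (w : nat -> M) (x : nat -> M) : nat -> M :=
  fun k => if (k < n)%N then w k else x (k - n)%N.

Definition shift (x : nat -> M) : nat -> M := fun k => x k.+1.

Definition Ssum (f : (nat -> M) -> R) (n : nat) (x : nat -> M) : R :=
  \sum_(i < n) f (iter i shift x).

Definition Cf (f : (nat -> M) -> R) (x y : nat -> M) : \bar R :=
  ereal_sup [set r : \bar R | exists (n : nat) (w : nat -> M), (0 < n)%N /\
               r = ((Ssum f n (pword n w x) - Ssum f n (pword n w y))%:E)].

Definition weak_walters (d : M -> M -> R) (f : (nat -> M) -> R) : Prop :=
  forall e : R, 0 < e -> exists2 del : R, 0 < del &
    forall x y, dOmega d x y < del -> (`|Cf f x y| < e%:E)%E.

Definition ruelle (d : M -> M -> R)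
  (mu : {measure set (g_sigma_algebraType (mopen d)) -> \bar R})
  (f : (nat -> M) -> R) (phi : (nat -> M) -> R) (x : nat -> M) : R :=
  Rintegral mu setT (fun a : g_sigma_algebraType (mopen d) =>
     expR (f (pcons a x)) * phi (pcons a x)).

Definition sup_norm (g : (nat -> M) -> R) : \bar R :=
  ereal_sup (range (fun x => (`|g x|)%:E)).

End Defs.

(* Main.v *)
Require Import Defs.
From HB Require Import structures.
From mathcomp Require Import all_boot all_order all_algebra.
From mathcomp Require Import all_classical all_reals all_analysis.
From mathcomp Require Import measurable_realfun lra.
Import Order.TTheory GRing.Theory Num.Theory.
Import numFieldNormedType.Exports.
Local Open Scope classical_set_scope.
Local Open Scope ring_scope.
Set Implicit Arguments. Unset Strict Implicit. Unset Printing Implicit Defensive.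

(** Iterates of the operator [L] at two points are compared inverse branch by
    inverse branch: the weak Walters condition gives a bounded distortion for
    [L^n 1] and makes the normalized iterates [lam^-n L^n phi] equicontinuous.
    Quasi-additivity of [ln (L^n 1)] along [n] yields the eigenvalue [lam], up to
    bounded multiplicative errors. With [T := L / lam], the upper limit [w] of
    [T^n 1] satisfies [w <= T w], and [h := sup_n T^n w] is a fixed point by
    Dini's theorem. As [mu] has full support, [T^k] sends a nonnegative function
    that is large on some ball to a function bounded below, so the oscillation
    of [T^n phi / h] tends to 0; its limit is a positive linear functional of
    [phi], hence integration against a probability measure by Riesz
    representation, obtained here from a Daniell outer measure. *)

(** * Continuity, compactness and integration on metric spaces *)

(** The weak Walters condition supplies a modulus of continuity without any rate, so no invariant
    space of Lipschitz functions and no spectral gap is available. Convergence is obtained by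
    contradiction instead: an oscillation of [T^n phi / h] that stays above some [e] would make the
    supremum of this ratio drop by a fixed amount every [k] steps, although it is bounded below. The
    eigenfunction is built before the eigenmeasure, from order and compactness alone. The measure is
    then read off from the limits of the iterates, so no fixed point theorem on a space of measures
    enters. Uniqueness comes from the same limits: an eigenmeasure for [lam] gives [T^n g] the same
    integral for every [n], while [T^n g] tends uniformly to a multiple of [h]. It is thus
    determined up to a factor, which its total mass fixes. The abstract part sees a positive
    operator only through three facts: two-sided bounds on the iterates of 1, equicontinuity of the
    iterates of each function, and a minorization on balls. *)

Section MetricContinuity.
Variables (R : realType) (T : pointedType) (dT : T -> T -> R).
Implicit Types (g h : T -> R) (x y : T).

Definition mball x (r : R) : set T := [set y | dT x y < r].

Definition mnbhs x : set_system T := filter_from [set r : R | 0 < r] (mball x).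

(** As a filter limit, continuity for a bare function [dT] inherits sums, products and compositions
    from the general limit theorems, without any metric axiom. *)
Global Instance mnbhs_filter x : Filter (mnbhs x).
Proof.
apply: filter_from_filter; first by exists 1 => /=.
move=> i j /= i0 j0; exists (Num.min i j); first by rewrite /= lt_min i0.
by move=> y; rewrite /mball /= lt_min => /andP.
Qed.

Lemma mcontinuousP g :
  mcontinuous dT g <-> forall x, g @ mnbhs x --> g x.
Proof.
split=> [gc x|gc x e e0].
  apply/cvgrPdist_lt => e e0; have [r r0 gr] := gc x e e0.
  by exists r => // y; exact: gr.
by have /cvgrPdist_lt /(_ e e0)[r r0 gr] := gc x; exists r.
Qed.

Lemma mcontinuous_cst (c : R) : mcontinuous dT (fun=> c).
Proof. by apply/mcontinuousP => x; exact: cvg_cst. Qed.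

Lemma mcontinuousD g h : mcontinuous dT g -> mcontinuous dT h ->
  mcontinuous dT (fun x => g x + h x).
Proof.
by move=> /mcontinuousP gc /mcontinuousP hc; apply/mcontinuousP => x; apply: cvgD.
Qed.

Lemma mcontinuousM g h : mcontinuous dT g -> mcontinuous dT h ->
  mcontinuous dT (fun x => g x * h x).
Proof.
by move=> /mcontinuousP gc /mcontinuousP hc; apply/mcontinuousP => x; apply: cvgM.
Qed.

Lemma mcontinuousZ (c : R) g : mcontinuous dT g ->
  mcontinuous dT (fun x => c * g x).
Proof. exact/mcontinuousM/mcontinuous_cst. Qed.

Lemma mcontinuousB g h : mcontinuous dT g -> mcontinuous dT h ->
  mcontinuous dT (fun x => g x - h x).
Proof.
by move=> /mcontinuousP gc /mcontinuousP hc; apply/mcontinuousP => x; apply: cvgB.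
Qed.

Lemma mcontinuous_comp (F : R -> R) g : continuous F -> mcontinuous dT g ->
  mcontinuous dT (fun x => F (g x)).
Proof.
move=> Fc /mcontinuousP gc; apply/mcontinuousP => x.
by apply: (@cvg_comp _ _ _ g F _ (nbhs (g x))); [exact: gc|exact: Fc].
Qed.

Lemma mcontinuous_min g (c : R) : mcontinuous dT g ->
  mcontinuous dT (fun x => Num.min (g x) c).
Proof.
move=> gc x e /(gc x)[r r0 gr]; exists r => // y /gr.
by rewrite !minEle; case: (leP (g x) c); case: (leP (g y) c) => ? ?;
  rewrite !ltr_norml => /andP[? ?]; apply/andP; split; lra.
Qed.

Lemma mcontinuous_sum (F : nat -> T -> R) N :
  (forall n, mcontinuous dT (F n)) ->
  mcontinuous dT (fun x => \sum_(i < N) F i x).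
Proof.
move=> Fc; elim: N => [|N IH].
  rewrite (_ : (fun _ => _) = fun=> 0); first exact: mcontinuous_cst.
  by apply/funext => x; rewrite big_ord0.
rewrite (_ : (fun _ => _) = fun x => \sum_(i < N) F i x + F N x).
  exact: mcontinuousD.
by apply/funext => x; rewrite big_ord_recr.
Qed.

Lemma mopen_gt g (c : R) : mcontinuous dT g -> mopen dT [set x | c < g x].
Proof.
move=> gc x /= cg; have [|r r0 gr] := gc x (g x - c); first lra.
by exists r => // y /gr; rewrite ltr_norml => /andP[? ?]; lra.
Qed.

Lemma mcontinuous_measurable g : mcontinuous dT g ->
  measurable_fun (setT : set (g_sigma_algebraType (mopen dT)))
    (g : g_sigma_algebraType (mopen dT) -> R).
Proof.
move=> gc; apply: (measurability _ (RGenOInfty.measurableE R)).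
move=> _ [_ [c ->] <-]; rewrite setTI; apply: sub_sigma_algebra.
rewrite (_ : _ @^-1` _ = [set x | c < g x]); first exact: mopen_gt.
by apply/seteqP; split=> x /=; rewrite in_itv /= andbT.
Qed.

Lemma mopen_measurable (U : set T) : mopen dT U ->
  measurable (U : set (g_sigma_algebraType (mopen dT))).
Proof. exact: sub_sigma_algebra. Qed.

End MetricContinuity.

(* Compactness as an induction principle over ideals of sets, which avoids
   handling finite subcovers. *)
Definition compact_ind (R : realType) (T : pointedType) (dT : T -> T -> R) :=
  forall Q : set T -> Prop, Q set0 ->
    (forall A B, A `<=` B -> Q B -> Q A) ->
    (forall A B, Q A -> Q B -> Q (A `|` B)) ->
    (forall x, exists2 r : R, 0 < r & Q (mball dT x r)) ->
    Q setT.

Lemma mball_open (R : realType) (T : pointedType) (dT : T -> T -> R) x r :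
  is_metric dT -> mopen dT (mball dT x r).
Proof.
move=> [_ _ _ tri] y /= xy; exists (r - dT x y); first by rewrite subr_gt0.
by move=> z yz; rewrite /mball /=; have := tri x y z; lra.
Qed.

Lemma mball_center (R : realType) (T : pointedType) (dT : T -> T -> R) x r :
  is_metric dT -> 0 < r -> mball dT x r x.
Proof. by move=> [_ d0 _ _] r0; rewrite /mball /= (d0 x x).2. Qed.

Lemma mcompact_compact_ind (R : realType) (T : pointedType) (dT : T -> T -> R) :
  is_metric dT -> mcompact dT -> compact_ind dT.
Proof.
move=> dm cT Q Q0 Qs QU Qloc.
have /choice[r r0] : forall x, exists r : R, 0 < r /\ Q (mball dT x r).
  by move=> x; have [r] := Qloc x; exists r.
have [|x|n [g gT]] := cT T (fun x => mball dT x (r x)).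
- by move=> x; exact: mball_open.
- by exists x; apply: mball_center => //; case: (r0 x).
- suff: Q (\big[setU/set0]_(k < n) mball dT (g k) (r (g k))).
    by apply: Qs => x _; have [k ?] := gT x; rewrite (bigD1 k)//=; left.
  by elim/big_ind: _ => // k _; case: (r0 (g k)).
Qed.

(** * Boundedness, uniform continuity and Dini's theorem by compactness *)

Section Compact.
Variables (R : realType) (T : pointedType) (dT : T -> T -> R).
Hypotheses (dm : is_metric dT) (cT : compact_ind dT).
Implicit Types (g h : T -> R) (x y : T).

Lemma mcontinuous_bounded g : mcontinuous dT g ->
  exists2 C : R, 0 < C & forall x, `|g x| <= C.
Proof.
move=> gc.
have [] : exists2 C : R, 0 < C & forall x, [set: T] x -> `|g x| <= C.
  apply: (cT (Q := fun A => exists2 C : R, 0 < C & forall x, A x -> `|g x| <= C)).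
  - by exists 1.
  - by move=> A B AB [C C0 BC]; exists C => // x /AB /BC.
  - move=> A B [C C0 AC] [D D0 BD]; exists (C + D); first lra.
    by move=> x [/AC|/BD]; lra.
  - move=> x; have [r r0 gr] := gc x 1 ltr01; exists r => //.
    exists (`|g x| + 1); first by have := normr_ge0 (g x); lra.
    move=> y /gr; rewrite distrC => gxy.
    by have := ler_normD (g x) (g y - g x); rewrite addrC subrK; lra.
by move=> C C0 gC; exists C => // x; exact: gC.
Qed.

Lemma mcontinuous_unif g : mcontinuous dT g -> forall e : R, 0 < e ->
  exists2 r : R, 0 < r & forall x y, dT x y < r -> `|g x - g y| < e.
Proof.
have [_ _ _ tri] := dm; move=> gc e e0.
have [] : exists2 r : R, 0 < r &
    forall x, [set: T] x -> forall y, dT x y < r -> `|g x - g y| < e.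
  apply: (cT (Q := fun A => exists2 r : R, 0 < r &
    forall x, A x -> forall y, dT x y < r -> `|g x - g y| < e)).
  - by exists 1.
  - by move=> A B AB [C C0 BC]; exists C => // x /AB /BC.
  - move=> A B [C C0 AC] [D D0 BD]; exists (Num.min C D); first by rewrite lt_min C0.
    by move=> x + y; rewrite lt_min => -[/AC|/BD] + /andP[? ?]; apply.
  - move=> x; have [|r r0 gr] := gc x (e / 2); first lra.
    exists (r / 2); first lra.
    exists (r / 2); first lra.
    move=> y xy z yz; rewrite /mball /= in xy.
    have /gr : dT x y < r by lra.
    have /gr : dT x z < r by have := tri x y z; lra.
    by rewrite !ltr_norml => /andP[? ?] /andP[? ?]; apply/andP; split; lra.
by move=> r r0 gr; exists r => // x; exact: gr.
Qed.

Lemma dini g (F : nat -> T -> R) : mcontinuous dT g ->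
  (forall n, mcontinuous dT (F n)) ->
  (forall x n, F n x <= F n.+1 x) ->
  (forall x (e : R), 0 < e -> exists n, g x < F n x + e) ->
  forall e : R, 0 < e -> exists n, forall x, g x < F n x + e.
Proof.
move=> gc Fc Fnd gF e e0.
have Fle x n m : (n <= m)%N -> F n x <= F m x.
  by have /nondecreasing_seqP := Fnd x; apply.
have [] : exists n, forall x, [set: T] x -> g x < F n x + e.
  apply: (cT (Q := fun A => exists n, forall x, A x -> g x < F n x + e)).
  - by exists 0%N.
  - by move=> A B AB [n H]; exists n => // x /AB /H.
  - move=> A B [n An] [m Bm]; exists (maxn n m) => x.
    have := Fle x _ _ (leq_maxl n m); have := Fle x _ _ (leq_maxr n m).
    by move=> ? ? [/An|/Bm]; lra.
  - move=> x; have [n gn] := gF x e e0.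
    have e'0 : 0 < e - (g x - F n x) by lra.
    have [r r0 gr] := mcontinuousB gc (Fc n) x e'0.
    exists r => //; exists n => y /gr.
    by rewrite ltr_norml => /andP[? ?]; lra.
by move=> n H; exists n => x; exact: H.
Qed.

(** * Integrals of continuous functions against a Borel probability *)

Section Integral.
Variable P : probability (g_sigma_algebraType (mopen dT)) R.
Local Notation I g := (Rintegral P setT (g : g_sigma_algebraType (mopen dT) -> R)).

Let Pfin : (P setT < +oo)%E.
Proof. by rewrite probability_setT ltry. Qed.

Lemma mcontinuous_integrable g : mcontinuous dT g ->
  P.-integrable setT (EFin \o (g : g_sigma_algebraType (mopen dT) -> R)).
Proof.
move=> gc; have [C C0 gC] := mcontinuous_bounded gc.
apply: measurable_bounded_integrable => //.
- exact: mcontinuous_measurable.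
- exists C; split; first by rewrite num_real.
  by move=> D CD x _; exact: le_trans (gC x) (ltW CD).
Qed.

Lemma mintD g h : mcontinuous dT g -> mcontinuous dT h ->
  I (fun x => g x + h x) = I g + I h.
Proof. by move=> gc hc; apply: RintegralD => //; exact: mcontinuous_integrable. Qed.

Lemma mintZ (c : R) g : mcontinuous dT g -> I (fun x => c * g x) = c * I g.
Proof. by move=> gc; apply: RintegralZl => //; exact: mcontinuous_integrable. Qed.

Lemma mint_le g h : mcontinuous dT g -> mcontinuous dT h ->
  (forall x, g x <= h x) -> I g <= I h.
Proof. by move=> gc hc gh; apply: le_Rintegral => //; exact: mcontinuous_integrable. Qed.

Lemma mint_cst (c : R) : I (fun=> c) = c.
Proof. by rewrite Rintegral_cst// [X in fine X](probability_setT P) mulr1. Qed.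

Let integrable_cst_patch (t : R) (A : set (g_sigma_algebraType (mopen dT))) :
  measurable A -> 0 <= t -> P.-integrable setT (EFin \o ((fun=> t) \_ A)).
Proof.
move=> mA t0; apply: measurable_bounded_integrable => //.
  exact/(measurable_restrictT _ mA)/measurable_cst.
exists t; split; first by rewrite num_real.
move=> D tD x _ /=; rewrite /patch; case: ifPn => _.
  by rewrite ger0_norm// ltW.
by rewrite normr0 ltW// (le_lt_trans t0).
Qed.

Lemma mint_ge g (t : R) (A : set T) : mcontinuous dT g -> mopen dT A ->
  0 <= t -> (forall x, 0 <= g x) -> (forall x, A x -> t <= g x) ->
  t * fine (P A) <= I g.
Proof.
move=> gc Ao t0 g0 gA; have mA := mopen_measurable Ao.
rewrite -(Rintegral_cst P mA t) [leLHS]Rintegral_mkcond.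
apply: le_Rintegral => //.
- exact: integrable_cst_patch.
- exact: mcontinuous_integrable.
- by move=> x _; rewrite /patch /=; case: ifPn => [/set_mem /gA //|_].
Qed.

Lemma mint_le_open g (t : R) (A : set T) : mcontinuous dT g -> mopen dT A ->
  0 <= t -> (forall x, g x <= t) -> (forall x, ~ A x -> g x <= 0) ->
  I g <= t * fine (P A).
Proof.
move=> gc Ao t0 gt gA; have mA := mopen_measurable Ao.
rewrite -(Rintegral_cst P mA t) [leRHS]Rintegral_mkcond.
apply: le_Rintegral => //.
- exact: mcontinuous_integrable.
- exact: integrable_cst_patch.
- move=> x _; rewrite /patch /=; case: ifPn => [_|/negP xA]; first exact: gt.
  by apply: gA => Ax; apply: xA; rewrite inE.
Qed.

Lemma mint_dist g h (e : R) : mcontinuous dT g -> mcontinuous dT h ->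
  (forall x, `|g x - h x| <= e) -> `|I g - I h| <= e.
Proof.
move=> gc hc gh.
have ec := mcontinuous_cst dT e.
have gh1 : I g <= I h + e.
  rewrite -(mint_cst e) -mintD//; apply: mint_le => //; first exact: mcontinuousD.
  by move=> x; have := gh x; rewrite ler_norml => /andP[? ?]; lra.
have gh2 : I h <= I g + e.
  rewrite -(mint_cst e) -mintD//; apply: mint_le => //; first exact: mcontinuousD.
  by move=> x; have := gh x; rewrite ler_norml => /andP[? ?]; lra.
by rewrite ler_norml; apply/andP; split; lra.
Qed.

End Integral.
End Compact.

(** * The sequence space *)

Lemma exists_geometric_lt (R : realType) (C e : R) : 0 < e ->
  exists k, (1 / 2) ^+ k * C < e.
Proof.
move=> e0; have e'0 : 0 < e / (`|C| + 1) by rewrite divr_gt0// ltr_wpDl.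
have h1 : `|1 / 2 : R| < 1 by rewrite ger0_norm; lra.
have /cvgrPdist_lt /(_ _ e'0)[k _ /(_ k (leqnn k))] := cvg_expr h1.
have p0 : 0 <= (1 / 2) ^+ k :> R by rewrite exprn_ge0//; lra.
have C1 : 0 < `|C| + 1 by rewrite ltr_wpDl.
rewrite sub0r normrN /= ger0_norm// ltr_pdivlMr// => H.
exists k; apply: le_lt_trans H; rewrite ler_wpM2l//.
by have := ler_norm C; lra.
Qed.

Section Omega.
Variables (R : realType) (M : pointedType) (d : M -> M -> R).
Hypotheses (dm : is_metric d) (cM : compact_ind d).
Implicit Types (x y z w : nat -> M) (a b : M).

(** In [iter n.+1 L] the outermost integral runs over the letter next to the tail [x], so inductions
    on the word length extend words at their right end. *)
Lemma pword_rcons n w a x :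
  pword n w (pcons a x) = pword n.+1 (fun k => if (k < n)%N then w k else a) x.
Proof.
apply/funext => k; rewrite /pword ltnS; case: ltngtP => // [nk|->].
  by rewrite -(subnSK nk).
by rewrite subnn.
Qed.

Lemma iter_shift_pword n w x : iter n (@Defs.shift M) (pword n w x) = x.
Proof.
have E k z : iter k (@Defs.shift M) z = fun i => z (i + k)%N.
  elim: k z => [|k IH] z; first by apply/funext => i; rewrite addn0.
  by rewrite iterS IH; apply/funext => i; rewrite /Defs.shift addnS.
rewrite E; apply/funext => i; rewrite /pword addnK.
by rewrite ltnNge leq_addl.
Qed.

Lemma SsumS (f : (nat -> M) -> R) n w a x :
  Ssum f n.+1 (pword n w (pcons a x)) =
  Ssum f n (pword n w (pcons a x)) + f (pcons a x).
Proof. by rewrite /Ssum big_ord_recr /= iter_shift_pword. Qed.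

Lemma metric_bounded : exists2 C : R, 0 < C & forall a b, d a b <= C.
Proof.
have [d0 _ ds tri] := dm.
have dc : mcontinuous d (d point).
  move=> a e e0; exists e => // b ab; rewrite ltr_norml.
  have := tri point a b; have := tri point b a; rewrite (ds b a) => ? ?.
  by apply/andP; split; lra.
have [C C0 dC] := mcontinuous_bounded cM dc.
exists (C + C); first lra.
move=> a b; have := tri a point b; rewrite (ds a point).
have := dC a; have := dC b; have := ler_norm (d point a).
have := ler_norm (d point b); lra.
Qed.

Let psum x y N : R := \sum_(0 <= n < N) ((2 ^- n.+1) * d (x n) (y n)).

Let psumS x y N :
  psum x y N.+1 = 1 / 2 * d (x 0%N) (y 0%N) + 1 / 2 * psum (Defs.shift x) (Defs.shift y) N.
Proof.
rewrite /psum big_nat_recl// expr1 div1r; congr (_ + _).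
by rewrite mulr_sumr; apply: eq_bigr => i _; rewrite exprS invfM mulrA.
Qed.

Let psum_nd x y : nondecreasing_seq (psum x y).
Proof.
have [d0 _ _ _] := dm.
apply/nondecreasing_seqP => n; rewrite /psum big_nat_recr//= lerDl.
by rewrite mulr_ge0// invr_ge0 exprn_ge0.
Qed.

Let psum_cvg x y : cvgn (psum x y).
Proof.
have [C C0 dC] := metric_bounded.
apply: nondecreasing_is_cvgn => //; exists C => _ [n _ <-].
elim: n x y => [|n IH] x y; first by rewrite /psum big_geq// ltW.
by rewrite psumS; have := dC (x 0%N) (y 0%N); have := IH (Defs.shift x) (Defs.shift y); lra.
Qed.

Let dO := dOmega d.

(** Self-similarity of the weights; it replaces manipulations of the series by inductions on the
    number of coordinates. *)
Lemma dOmega_shift x y :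
  dO x y = 1 / 2 * d (x 0%N) (y 0%N) + 1 / 2 * dO (Defs.shift x) (Defs.shift y).
Proof.
have H : (fun n => psum x y n.+1) @ \oo --> dO x y.
  by rewrite (cvg_shiftS (psum x y)); exact: psum_cvg.
(* The shifted partial sums have the same limit as the unshifted ones, and [psumS] computes that
   limit a second time. *)
apply: (cvg_unique _ H) => //.
rewrite (_ : (fun _ => _) = fun n => 1 / 2 * d (x 0%N) (y 0%N) +
    1 / 2 * psum (Defs.shift x) (Defs.shift y) n); last exact/funext/psumS.
apply: cvgD; first exact: cvg_cst.
by apply: cvgM; [exact: cvg_cst|exact: psum_cvg].
Qed.

Lemma dOmega_pcons a b x y : dO (pcons a x) (pcons b y) = 1 / 2 * d a b + 1 / 2 * dO x y.
Proof. by rewrite dOmega_shift. Qed.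

Let psum_le x y n : psum x y n <= dO x y.
Proof. exact: nondecreasing_cvgn_le. Qed.

Let dO_le x y (B : R) : (forall n, psum x y n <= B) -> dO x y <= B.
Proof.
by move=> H; apply: limr_le; [exact: psum_cvg|exact: nearW].
Qed.

Lemma dOmega_ge0 x y : 0 <= dO x y.
Proof. by have := psum_le x y 0; rewrite /psum big_geq. Qed.

Lemma dOmega_coord x y n : d (x n) (y n) <= 2 ^+ n.+1 * dO x y.
Proof.
have [d0 _ _ _] := dm.
elim: n x y => [|n IH] x y.
  rewrite dOmega_shift expr1; have := dOmega_ge0 (Defs.shift x) (Defs.shift y); lra.
rewrite dOmega_shift exprS -mulrA mulrCA; apply: (le_trans (IH (Defs.shift x) (Defs.shift y))).
rewrite ler_wpM2l ?exprn_ge0//; have := d0 (x 0%N) (y 0%N); lra.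
Qed.

Lemma dOmega_metric : is_metric dO.
Proof.
have [d0 deq ds tri] := dm; split=> [x y|x y|x y|x y z].
- exact: dOmega_ge0.
- split=> [xy|->].
    apply/funext => n; apply/deq/eqP; rewrite eq_le d0 andbT.
    by have := dOmega_coord x y n; rewrite xy mulr0.
  apply/eqP; rewrite eq_le dOmega_ge0 andbT; apply: dO_le => n.
  by rewrite /psum big1// => i _; rewrite (deq _ _).2// mulr0.
- rewrite /dO /dOmega; congr (limn _); apply/funext => n.
  by apply: eq_bigr => i _; rewrite ds.
- apply: dO_le => n; apply: (@le_trans _ _ (psum x y n + psum y z n)).
    rewrite /psum -big_split/=; apply: ler_sum => i _.
    by rewrite -mulrDr ler_wpM2l// invr_ge0 exprn_ge0.
  by apply: lerD; exact: psum_le.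
Qed.

(** The first [k] weights sum to at most 1 and the remaining ones to [2^-k]. *)
Lemma dOmega_cyl (C r : R) k x y : (forall a b, d a b <= C) -> 0 <= r ->
  (forall i, (i < k)%N -> d (x i) (y i) <= r) -> dO x y <= r + (1 / 2) ^+ k * C.
Proof.
move=> dC r0; elim: k x y => [|k IH] x y xy.
  suff : dO x y <= C by rewrite expr0; lra.
  apply: dO_le => n; elim: n x y {xy} => [|n IH] x y.
    rewrite /psum big_geq//; apply: le_trans (dC point point).
    by have [] := dm.
  by rewrite psumS; have := dC (x 0%N) (y 0%N); have := IH (Defs.shift x) (Defs.shift y); lra.
rewrite dOmega_shift exprS.
have := xy 0%N isT; have : dO (Defs.shift x) (Defs.shift y) <= r + (1 / 2) ^+ k * C.
  by apply: IH => i ik; apply: xy.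
by lra.
Qed.

Lemma dOmega_pword n w x y : dO (pword n w x) (pword n w y) = (1 / 2) ^+ n * dO x y.
Proof.
have [_ deq _ _] := dm.
elim: n w => [|n IH] w.
  by rewrite expr0 mul1r; congr dO; apply/funext => k; rewrite /pword subn0.
rewrite dOmega_shift /= {1 2}/pword /= (deq _ _).2// mulr0 add0r exprS -[RHS]mulrA.
by rewrite -(IH (Defs.shift w)).
Qed.

Lemma dOmega_pword_le n w x y : dO (pword n w x) (pword n w y) <= dO x y.
Proof.
rewrite dOmega_pword ler_piMl ?dOmega_ge0// exprn_ile1//; lra.
Qed.

Lemma mcontinuous_pcons (F : (nat -> M) -> R) x : mcontinuous dO F ->
  mcontinuous d (fun a => F (pcons a x)).
Proof.
have [_ oeq _ _] := dOmega_metric.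
move=> Fc a e e0; have [r r0 Fr] := Fc (pcons a x) e e0; exists r => // b ab.
by apply: Fr; rewrite dOmega_pcons (oeq x x).2//; have [d0 _ _ _] := dm; have := d0 a b; lra.
Qed.

Definition cyl x k (r : R) : set (nat -> M) :=
  [set z | forall i, (i < k)%N -> d (x i) (z i) < r].

(* If the ideal misses the whole space, one chooses the coordinates of a point
   one at a time, keeping every cylinder around it outside the ideal. *)
Lemma Omega_compact_ind : compact_ind dO.
Proof.
move=> Q Q0 Qs QU Qloc; apply: contrapT => NQ.
(* If every letter had a ball whose slice of a cylinder lies in the ideal, compactness of [M] would
   glue these slices into a whole cylinder of length [k], at the smallest radius used. *)
have step x k : (forall r : R, 0 < r -> ~ Q (cyl x k r)) ->
    exists a, forall r : R, 0 < r -> ~ Q (cyl x k r `&` [set z | d a (z k) < r]).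
  move=> H; apply: contrapT => /forallNP H1.
  have [] : exists2 r : R, 0 < r & Q (cyl x k r `&` [set z | [set: M] (z k)]).
    apply: (cM (Q := fun A => exists2 r : R, 0 < r & Q (cyl x k r `&` [set z | A (z k)]))).
    - by exists 1 => //; apply: Qs Q0 => z [].
    - by move=> A B AB [r r0 H2]; exists r => //; apply: Qs H2 => z [? /AB].
    - move=> A B [r r0 H2] [s s0 H3]; exists (Num.min r s); first by rewrite lt_min r0.
      apply: Qs (QU _ _ H2 H3) => z [zr [zA|zB]]; [left|right]; split=> // i /zr;
        by rewrite lt_min => /andP[].
    - move=> a; have /existsNP[r /not_implyP[r0 /contrapT H2]] := H1 a.
      by exists r => //; exists r.
  by move=> r r0 H2; apply: (H r r0); apply: Qs H2 => z.
(* The badness assumption moves inside the existential, with [point] as a default letter, so that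
   one function [G] serves all prefixes. *)
have /choice[G HG] : forall p : (nat -> M) * nat, exists a,
    (forall r : R, 0 < r -> ~ Q (cyl p.1 p.2 r)) ->
    forall r : R, 0 < r -> ~ Q (cyl p.1 p.2 r `&` [set z | d a (z p.2) < r]).
  move=> [x k] /=; have [H|H] := pselect (forall r : R, 0 < r -> ~ Q (cyl x k r)).
    by have [a Ha] := step x k H; exists a.
  by exists point.
(* Only the first [k] coordinates of [X k] matter; stage [k.+1] overwrites coordinate [k]. The
   diagonal [X i.+1 i] is the point produced in the end. *)
pose X := fix X k : nat -> M := if k is k'.+1 then
  fun i => if i == k' then G (X k', k') else X k' i else fun=> point.
have bad k : forall r : R, 0 < r -> ~ Q (cyl (X k) k r).
  elim: k => [|k IH] r r0 Hr; first by apply: NQ; apply: Qs Hr => z _ i.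
  apply: (HG (X k, k) IH r r0) => /=; apply: Qs Hr => z [z1 z2] i.
  rewrite ltnS leq_eqVlt => /orP[/eqP ->|ik]; first by rewrite /= eqxx.
  by rewrite /= ltn_eqF//; exact: z1.
have Xst k i : (i < k)%N -> X k i = X i.+1 i.
  elim: k => // k IH; rewrite ltnS leq_eqVlt => /orP[/eqP -> //|ik].
  have -> : X k.+1 i = if i == k then G (X k, k) else X k i by [].
  by rewrite ltn_eqF// IH.
have [C C0 dC] := metric_bounded.
have [r r0 Hr] := Qloc (fun i => X i.+1 i).
have r20 : 0 < r / 4 by lra.
have [k kr] := exists_geometric_lt C r20.
(* A small ball around the diagonal point is in the ideal, yet it contains a long thin cylinder that
   is not. *)
apply: (bad k _ r20); apply: Qs Hr => z zc; rewrite /mball /=.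
apply: le_lt_trans (_ : r / 4 + (1 / 2) ^+ k * C < _); last lra.
apply: dOmega_cyl => //; first lra.
by move=> i ik; apply: ltW; have := zc i ik; rewrite (Xst _ _ ik).
Qed.

End Omega.

(** * Riesz representation *)

Section Bump.
Variables (R : realType) (T : pointedType) (dT : T -> T -> R).
Hypothesis dm : is_metric dT.
Variable U : set T.
Implicit Types (x y : T) (k : nat).

(** The infimum is the minimum of 1 and [k] times the distance to the complement of [U]. Including 1
    in the set keeps it nonempty when [U] is the whole space. *)
Let bset k x : set R := [set 1] `|` [set k%:R * dT x y | y in ~` U].

Definition bump k x : R := inf (bset k x).

Let bset_lb k x : lbound (bset k x) 0.
Proof. by have [d0 _ _ _] := dm; move=> _ [->|[y _ <-]] //; rewrite mulr_ge0. Qed.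

Let bset1 k x : bset k x 1. Proof. by left. Qed.

Let bump_le k x r : bset k x r -> bump k x <= r.
Proof. by move=> br; apply: ge_inf => //; exists 0; exact: bset_lb. Qed.

Let le_bump k x r : lbound (bset k x) r -> r <= bump k x.
Proof. by move=> br; apply: lb_le_inf => //; exists 1. Qed.

Lemma bump_ge0 k x : 0 <= bump k x. Proof. exact/le_bump/bset_lb. Qed.

Lemma bump_le1 k x : bump k x <= 1. Proof. exact: bump_le. Qed.

Lemma bump_out k x : ~ U x -> bump k x = 0.
Proof.
have [_ deq _ _] := dm.
move=> Ux; apply/eqP; rewrite eq_le bump_ge0 andbT; apply: bump_le.
by right; exists x => //; rewrite (deq _ _).2// mulr0.
Qed.

Lemma bump_nd k x : bump k x <= bump k.+1 x.
Proof.
have [d0 _ _ _] := dm; apply: le_bump => _ [->|[y Uy <-]]; first exact: bump_le1.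
apply: (@le_trans _ _ (k%:R * dT x y)); first by apply: bump_le; right; exists y.
by rewrite ler_wpM2r// ler_nat.
Qed.

Lemma bump_in x : mopen dT U -> U x -> exists k, bump k x = 1.
Proof.
move=> Uo /Uo[r r0 xr]; pose k := (Num.truncn r^-1).+1; exists k.
have kr : 1 <= k%:R * r.
  by rewrite -ler_pdivrMr// div1r ltW// truncnS_gt.
apply/eqP; rewrite eq_le bump_le1; apply: le_bump => _ [->//|[y Uy <-]].
apply: (le_trans kr); rewrite ler_wpM2l// leNgt.
by apply/negP => /xr.
Qed.

Lemma bump_continuous k : mcontinuous dT (bump k).
Proof.
have [d0 _ ds tri] := dm.
have lip x y : bump k x - k%:R * dT x y <= bump k y.
  apply: le_bump => _ [->|[z Uz <-]].
    by have := bump_le1 k x; have := d0 x y; have : 0 <= k%:R :> R by []; nra.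
  have : bump k x <= k%:R * dT x z by apply: bump_le; right; exists z.
  by have := tri x y z; have : 0 <= k%:R :> R by []; nra.
(* The function is [k]-Lipschitz; dividing by [k.+1] covers [k = 0] as well. *)
move=> x e e0; have k1 : 0 < k.+1%:R :> R by [].
exists (e / k.+1%:R); first by rewrite divr_gt0.
move=> y; rewrite ltr_pdivlMr// -natr1 mulrC => xy.
have := lip x y; have := lip y x; rewrite (ds y x) ltr_norml => ? ?.
by have := d0 x y; move=> ?; apply/andP; split; nra.
Qed.

End Bump.

(** * A Borel probability is determined by its integrals of continuous functions *)

Section Uniqueness.
Variables (R : realType) (T : pointedType) (dT : T -> T -> R).
Hypotheses (dm : is_metric dT) (cT : compact_ind dT).

Let le_open (P1 P2 : probability (g_sigma_algebraType (mopen dT)) R) (U : set T) :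
  (forall g : T -> R, mcontinuous dT g ->
    Rintegral P1 setT (g : g_sigma_algebraType (mopen dT) -> R) =
    Rintegral P2 setT (g : g_sigma_algebraType (mopen dT) -> R)) ->
  mopen dT U -> (P1 U <= P2 U)%E.
Proof.
move=> P12 Uo.
pose V k : set (g_sigma_algebraType (mopen dT)) := [set x | 1 / 2 < bump dT U k x].
have Vo k : mopen dT (V k) by apply: mopen_gt; exact: bump_continuous.
have VU : \bigcup_k V k = U.
  apply/seteqP; split=> [x [k _]|x Ux].
    by rewrite /V /= => Vx; apply: contrapT => /(bump_out dm k) E; move: Vx; rewrite E; lra.
  by have [k E] := bump_in dm Uo Ux; exists k => //; rewrite /V /= E; lra.
have mU := mopen_measurable Uo.
have Vcvg : P1 \o V @ \oo --> P1 U.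
  rewrite -VU; apply: nondecreasing_cvg_mu.
  - by move=> k; exact: mopen_measurable.
  - by rewrite VU.
  - apply/nondecreasing_seqP => k; apply/subsetPset => x; rewrite /V /= => Vx.
    exact: lt_le_trans (bump_nd dm U k x).
rewrite -(cvg_lim _ Vcvg)//; apply: lime_le; first by apply/cvg_ex; exists (P1 U).
apply: nearW => k /=.
have mV := mopen_measurable (Vo k).
rewrite -[leLHS]fineK ?fin_num_measure// -[leRHS]fineK ?fin_num_measure// lee_fin.
(* This function equals 1 on [V k] and vanishes off [U], so its common integral lies between
   [P1 (V k)] and [P2 U]. *)
pose g x := Num.min (2 * bump dT U k x) 1.
have gc : mcontinuous dT g by apply: mcontinuous_min; apply/mcontinuousZ/bump_continuous.
rewrite -[leLHS]mul1r -[leRHS]mul1r.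
apply: (@le_trans _ _ (Rintegral P1 setT (g : g_sigma_algebraType (mopen dT) -> R))).
  apply: mint_ge => // x; rewrite /g le_min.
    by rewrite ler01 andbT mulr_ge0// bump_ge0.
  by rewrite /V /= => Vx; apply/andP; split => //; lra.
rewrite P12//; apply: mint_le_open => // x; rewrite /g ge_min.
  by rewrite lexx orbT.
by move=> /(bump_out dm k) ->; rewrite mulr0 lexx.
Qed.

(** Open sets are stable under intersection and generate the Borel sets, so agreement on them
    suffices; [le_open] gives it in both directions. *)
Lemma mint_unique (P1 P2 : probability (g_sigma_algebraType (mopen dT)) R) :
  (forall g : T -> R, mcontinuous dT g ->
    Rintegral P1 setT (g : g_sigma_algebraType (mopen dT) -> R) =
    Rintegral P2 setT (g : g_sigma_algebraType (mopen dT) -> R)) ->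
  forall A : set (g_sigma_algebraType (mopen dT)), measurable A -> P1 A = P2 A.
Proof.
move=> P12 A mA.
apply: (@measure_unique _ R (g_sigma_algebraType (mopen dT)) (mopen dT)
  (fun=> setT) _ _ _ _ P1 P2) => //.
- move=> U V Uo Vo x [Ux Vx]; have [r r0 rU] := Uo x Ux; have [s s0 sV] := Vo x Vx.
  exists (Num.min r s); first by rewrite lt_min r0.
  by move=> y; rewrite lt_min => /andP[/rU ? /sV ?].
- by move=> _ x _; exists 1.
- by rewrite bigcup_const//; exists 0%N.
- move=> U Uo; apply/eqP; rewrite eq_le; apply/andP; split.
    exact: le_open.
  by apply: le_open => // g gc; rewrite P12.
- by move=> _; rewrite [X in (X < _)%E](probability_setT P1) ltry.
Qed.

End Uniqueness.

(** * From a positive normalized functional to a probability measure *)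

Section Riesz.
Variables (R : realType) (T : pointedType) (dT : T -> T -> R).
Hypotheses (dm : is_metric dT) (cT : compact_ind dT).
Variable l : (T -> R) -> R.
Hypothesis lD : forall g h, mcontinuous dT g -> mcontinuous dT h ->
  l (fun x => g x + h x) = l g + l h.
Hypothesis lZ : forall (c : R) g, mcontinuous dT g -> l (fun x => c * g x) = c * l g.
Hypothesis l0 : forall g, mcontinuous dT g -> (forall x, 0 <= g x) -> 0 <= l g.
Hypothesis l1 : l (fun=> 1) = 1.

Let lB g h : mcontinuous dT g -> mcontinuous dT h ->
  l (fun x => g x - h x) = l g - l h.
Proof.
move=> gc hc; rewrite -[l h]mul1r -mulNr -lZ// -lD//; last exact: mcontinuousZ.
by congr l; apply/funext => x; rewrite mulN1r.
Qed.

Let lle g h : mcontinuous dT g -> mcontinuous dT h -> (forall x, g x <= h x) ->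
  l g <= l h.
Proof.
move=> gc hc gh; rewrite -subr_ge0 -lB//; apply: l0; first exact: mcontinuousB.
by move=> x; rewrite subr_ge0.
Qed.

Let lsum (F : nat -> T -> R) N : (forall n, mcontinuous dT (F n)) ->
  l (fun x => \sum_(i < N) F i x) = \sum_(i < N) l (F i).
Proof.
move=> Fc; elim: N => [|N IH].
  rewrite big_ord0 -[RHS](mul0r (l (fun=> 1))) -lZ; last exact: mcontinuous_cst.
  by congr l; apply/funext => x; rewrite big_ord0 mul0r.
rewrite big_ord_recr /= -IH -lD//; last exact: mcontinuous_sum.
by congr l; apply/funext => x; rewrite big_ord_recr.
Qed.

(* S bounds l along an increasing sequence of functions eventually above the
   indicator of A; the infimum of such S is the Daniell outer measure of A. *)
Definition dcover (A : set T) : set R := [set S | exists F : nat -> T -> R,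
  [/\ forall n, mcontinuous dT (F n),
      forall n x, 0 <= F n x,
      forall n x, F n x <= F n.+1 x,
      forall n, l (F n) <= S &
      forall x, A x -> forall e : R, 0 < e -> exists n, 1 - e < F n x]].

Definition douter (A : set T) : R := inf (dcover A).

Let dcover1 A : dcover A 1.
Proof.
exists (fun _ _ => 1); split=> // [n|n|x _ e e0].
- exact: mcontinuous_cst.
- by rewrite l1.
- by exists 0%N; lra.
Qed.

Let dcover_lb A : lbound (dcover A) 0.
Proof. by move=> S [F [Fc F0 _ /(_ 0%N) FS _]]; exact: le_trans (l0 _ _) FS. Qed.

Let douter_le A S : dcover A S -> douter A <= S.
Proof. by move=> AS; apply: ge_inf => //; exists 0; exact: dcover_lb. Qed.

Let le_douter A r : lbound (dcover A) r -> r <= douter A.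
Proof. by move=> Ar; apply: lb_le_inf => //; exists 1. Qed.

Let douter_adh A (e : R) : 0 < e -> exists2 S, dcover A S & S < douter A + e.
Proof.
move=> e0; apply: inf_adherent => //; split; first by exists 1.
by exists 0; exact: dcover_lb.
Qed.

Definition douterE (A : set T) : \bar R := (douter A)%:E.

Let douterE0 : douterE set0 = 0%E.
Proof.
congr EFin; apply/eqP; rewrite eq_le le_douter ?andbT; last exact: dcover_lb.
have l00 : l (fun=> 0) = 0.
  rewrite -[RHS](mul0r (l (fun=> 1))) -lZ; last exact: mcontinuous_cst.
  by congr l; apply/funext => x; rewrite mul0r.
apply: douter_le; exists (fun _ _ => 0); split=> //.
- by move=> _; exact: mcontinuous_cst.
- by rewrite l00.
Qed.

Let douterE_ge0 A : (0 <= douterE A)%E.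
Proof. by rewrite lee_fin le_douter//; exact: dcover_lb. Qed.

Let douterE_le : {homo douterE : A B / A `<=` B >-> (A <= B)%E}.
Proof.
move=> A B AB; rewrite lee_fin; apply: le_douter => S [F [? ? ? ? FB]].
by apply: douter_le; exists F; split=> // x /AB; exact: FB.
Qed.

Let nd_le (F : nat -> T -> R) x : (forall n y, F n y <= F n.+1 y) ->
  forall m k, (m <= k)%N -> F m x <= F k x.
Proof. by move=> Fnd; apply/nondecreasing_seqP => n; exact: Fnd. Qed.

Let douterE_sigma : sigma_subadditive douterE.
Proof.
move=> A; apply/lee_addgt0Pr => e e0.
(* The series enters only as an upper bound [B] of its partial sums; an infinite [B] is disposed of
   at once. *)
have := @nneseries_lim_ge _ (fun i => douterE (A i)) xpredT 0.
move: (\sum_(i <oo) _)%E => B HB.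
have {}HB k : (\sum_(0 <= i < k) douterE (A i) <= B)%E by apply: HB.
case: B HB => [b|_|/(_ 0%N)]; last 2 first.
- by rewrite addye// leey.
- by rewrite big_geq.
move=> HB; have {}HB k : \sum_(i < k) douter (A i) <= b.
  by have := HB k; rewrite /douterE sumEFin lee_fin big_mkord.
rewrite -EFinD lee_fin; apply: douter_le.
have p0 i : 0 < e * (1 / 2) ^+ i.+1 by rewrite mulr_gt0// exprn_gt0//; lra.
have /choice[F HF] : forall i, exists F : nat -> T -> R,
  [/\ forall n, mcontinuous dT (F n),
      forall n x, 0 <= F n x,
      forall n x, F n x <= F n.+1 x,
      forall n, l (F n) <= douter (A i) + e * (1 / 2) ^+ i.+1 &
      forall x, A i x -> forall e : R, 0 < e -> exists n, 1 - e < F n x].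
  move=> i; have [S [F [? ? ? FS ?]] AS] := douter_adh (A i) (p0 i).
  by exists F; split=> // n; apply: le_trans (FS n) (ltW AS).
(* Diagonal sum: stage [n] uses the [n]-th function of each of the first [n] covers, which keeps it
   continuous and nondecreasing in [n]. The excesses [e 2^-(i+1)] add up to at most [e]. *)
exists (fun n x => \sum_(i < n) F i n x); split.
- by move=> n; apply: (mcontinuous_sum (F := fun i => F i n)) => i; case: (HF i).
- by move=> n x; apply: sumr_ge0 => i _; case: (HF i).
- move=> n x; rewrite big_ord_recr /= -[leLHS]addr0; apply: lerD.
    by apply: ler_sum => i _; case: (HF i).
  by case: (HF n).
- move=> n; rewrite (lsum (F := fun i => F i n)); last by move=> i; case: (HF i).
  apply: (@le_trans _ _ (\sum_(i < n) (douter (A i) + e * (1 / 2) ^+ i.+1))).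
    by apply: ler_sum => i _; case: (HF i).
  rewrite big_split /=; apply: lerD; first exact: HB.
  suff -> : \sum_(i < n) e * (1 / 2) ^+ i.+1 = e - e * (1 / 2) ^+ n.
    by rewrite gerBl mulr_ge0 ?exprn_ge0// ?ltW//; lra.
  elim: n => [|n IH]; first by rewrite big_ord0 expr0; lra.
  by rewrite big_ord_recr /= IH exprS; lra.
- move=> x [i _ Ai] e' e'0.
  have [Fc F0 Fnd _ /(_ x Ai _ e'0)[n Fn]] := HF i.
  exists (maxn n i.+1); apply: (lt_le_trans Fn).
  apply: (le_trans (nd_le x Fnd (leq_maxl n i.+1))).
  rewrite (bigD1 (Ordinal (leq_maxr n i.+1)))//= lerDl.
  by apply: sumr_ge0 => j _; case: (HF j).
Qed.

HB.instance Definition _ := isOuterMeasure.Build R T douterE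
  douterE0 douterE_ge0 douterE_le douterE_sigma.

(** A cover [F] of [X] is split by the bump functions of [U]: [F n * b n] covers [X] inside [U],
    while [F n * (1 - b k)] with [k] fixed covers [X] outside [U], where [b k] vanishes. *)
Let open_caratheodory (U : set T) : mopen dT U -> douterE.-caratheodory U.
Proof.
move=> Uo; apply: le_caratheodory_measurable => X.
rewrite /= /douterE -EFinD lee_fin.
apply/ler_addgt0Pr => e e0.
have [S [F [Fc F0 Fnd FS FX]] SX] := douter_adh X e0.
apply: le_trans (ltW SX).
pose b := bump dT U.
have bc := bump_continuous dm U.
have b0 := bump_ge0 dm U. have b1 := bump_le1 dm U.
have bnd := bump_nd dm U.
pose c := sup (range (fun n => l (fun x => F n x * b n x))).
have Fbc n k : mcontinuous dT (fun x => F n x * b k x) by exact: mcontinuousM.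
have Fb1c n k : mcontinuous dT (fun x => F n x * (1 - b k x)).
  by apply: mcontinuousM => //; apply: mcontinuousB => //; exact: mcontinuous_cst.
have lec n : l (fun x => F n x * b n x) <= c.
  apply: ub_le_sup; last by exists n.
  exists S => _ [m _ <-]; apply: le_trans (FS m); apply: lle => // x.
  by rewrite ler_piMr.
have H1 : douter (X `&` U) <= c.
  apply: douter_le; exists (fun n x => F n x * b n x); split=> //.
  - by move=> n x; rewrite mulr_ge0// b0.
  - by move=> n x; apply: ler_pM; rewrite ?b0 ?bnd.
  - move=> x [Xx Ux] e' e'0; have [n Fn] := FX x Xx e' e'0.
    have [k bk] := bump_in dm Uo Ux.
    exists (maxn n k); apply: (lt_le_trans Fn).
    have -> : b (maxn n k) x = 1.
      apply/eqP; rewrite eq_le b1 /= -bk.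
      exact: nd_le (leq_maxr n k).
    by rewrite mulr1; apply: nd_le => //; exact: leq_maxl.
have H2 k : douter (X `&` ~` U) <= S - l (fun x => F k x * b k x).
  apply: douter_le; exists (fun n x => F n x * (1 - b k x)); split=> //.
  - by move=> n x; rewrite mulr_ge0// subr_ge0 b1.
  - by move=> n x; apply: ler_wpM2r => //; rewrite subr_ge0 b1.
  (* Passing to index [maxn n k] makes both [F n] and [F k] comparable with the same function. *)
  - move=> n; apply: (@le_trans _ _ (l (fun x => F (maxn n k) x * (1 - b k x)))).
      apply: lle => // x; apply: ler_wpM2r; first by rewrite subr_ge0 b1.
      by apply: nd_le => //; exact: leq_maxl.
    have -> : l (fun x => F (maxn n k) x * (1 - b k x)) =
        l (F (maxn n k)) - l (fun x => F (maxn n k) x * b k x).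
      by rewrite -lB//; congr l; apply/funext => x; rewrite mulrBr mulr1.
    apply: lerB => //; apply: lle => // x; apply: ler_wpM2r; first exact: b0.
    by apply: nd_le => //; exact: leq_maxr.
  - move=> x [Xx Ux] e' e'0; have [n Fn] := FX x Xx e' e'0.
    by exists n; rewrite /b bump_out// subr0 mulr1.
suff : c <= S - douter (X `&` ~` U) by lra.
apply: ge_sup; first by exists (l (fun x => F 0%N x * b 0%N x)); exists 0%N.
by move=> _ [k _ <-]; have := H2 k; lra.
Qed.

Definition rmeasure : set (g_sigma_algebraType (mopen dT)) -> \bar R := douterE.

Let rmeasure_caratheodory (A : set (g_sigma_algebraType (mopen dT))) :
  measurable A -> douterE.-caratheodory A.
Proof.
apply: smallest_sub; last exact: open_caratheodory.
exact: (@sigma_algebra_measurable _ (caratheodory_type douterE)).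
Qed.

Let rmeasure0 : rmeasure set0 = 0%E. Proof. exact: douterE0. Qed.

Let rmeasure_ge0 A : (0 <= rmeasure A)%E. Proof. exact: douterE_ge0. Qed.

Let rmeasure_sigma_additive : semi_sigma_additive rmeasure.
Proof.
move=> F mF tF mUF; rewrite /rmeasure.
apply: caratheodory_measure_sigma_additive => //; last exact: rmeasure_caratheodory.
by move=> i; exact: (rmeasure_caratheodory (mF i)).
Qed.

HB.instance Definition _ := isMeasure.Build _ _ _ rmeasure
  rmeasure0 rmeasure_ge0 rmeasure_sigma_additive.

Let rmeasureT : rmeasure setT = 1%E.
Proof.
congr EFin; apply/eqP; rewrite eq_le douter_le//=.
apply: le_douter => S [F [Fc F0 Fnd FS FT]].
apply/ler_addgt0Pr => e e0.
have onec := mcontinuous_cst dT (1 : R).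
have F1 x (e' : R) : 0 < e' -> exists n, 1 < F n x + e'.
  by move=> e'0; have [n ?] := FT x I e' e'0; exists n; lra.
(* Compactness enters here: a cover of the whole space exceeds [1 - e] everywhere at a single stage,
   so its bound is at least [l 1 - e]. *)
have [n Fn] := dini cT onec Fc (fun x n => Fnd n x) F1 e0.
apply: (@le_trans _ _ (l (F n) + e)); last by rewrite lerD2r.
have ec : mcontinuous dT (fun=> e * 1) by exact: mcontinuous_cst.
have -> : l (F n) + e = l (fun x => F n x + e * 1) by rewrite lD// lZ// l1 mulr1.
rewrite -[leLHS]l1; apply: lle => //; first exact: mcontinuousD.
by move=> x; rewrite mulr1 ltW.
Qed.

HB.instance Definition _ := Measure_isProbability.Build _ _ _ rmeasure rmeasureT.

Local Notation I g := (Rintegral rmeasure setT (g : g_sigma_algebraType (mopen dT) -> R)).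

(** Layer-cake argument with horizontal slices of height [s]. Slice [m.+1] lives where [g] exceeds
    [m.+1 * s], and slice [m] is full there, so it yields a cover of that set once divided by [s].
    The shift by one slice costs only [s]. *)
Let mint_le_functional01 g : mcontinuous dT g -> (forall x, 0 <= g x <= 1) ->
  I g <= l g.
Proof.
move=> gc g01; apply/ler_addgt0Pr => s s0.
pose G (m : nat) x := Num.min (g x) (m%:R * s).
have Gc m : mcontinuous dT (G m) by exact: mcontinuous_min.
have G1c m : mcontinuous dT (fun x => G m.+1 x - G m x) by exact: mcontinuousB.
have G0 m x : 0 <= G m x.
  by have /andP[? _] := g01 x; rewrite /G le_min; apply/andP; split=> //;
    rewrite mulr_ge0// ltW.
have U m : mopen dT [set x | m%:R * s < g x] by exact: mopen_gt.
have mS k : k.+1%:R * s = k%:R * s + s by rewrite -natr1 mulrDl mul1r.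
have minD_le u a : Num.min u (a + s) - Num.min u a <= s.
  by rewrite !minEle; case: (leP u (a + s)) => ?; case: (leP u a) => ?; lra.
have minD_le0 u a : u <= a -> Num.min u (a + s) - Num.min u a <= 0.
  by rewrite !minEle; case: (leP u (a + s)) => ?; case: (leP u a) => ?; lra.
have minD_eq u a : a + s < u -> Num.min u (a + s) - Num.min u a = s.
  by rewrite !minEle; case: (leP u (a + s)) => ?; case: (leP u a) => ?; lra.
have step m : I (fun x => G m.+2 x - G m.+1 x) <= l (fun x => G m.+1 x - G m x).
  apply: (@le_trans _ _ (s * fine (rmeasure [set x | m.+1%:R * s < g x]))).
    apply: mint_le_open => //; first exact: ltW.
      by move=> x; rewrite /G mS minD_le.
    by move=> x /negP; rewrite -leNgt => gx; rewrite /G mS minD_le0.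
  rewrite -ler_pdivlMl// -lZ//; apply: douter_le.
  exists (fun _ x => s^-1 * (G m.+1 x - G m x)); split=> //.
  - by move=> _; exact: mcontinuousZ.
  - move=> _ x; apply: mulr_ge0; first by rewrite invr_ge0 ltW.
    by rewrite subr_ge0 /G mS le_min !ge_min lexx /= lerDl (ltW s0) orbT.
  - move=> x /= gx e e0; exists 0%N.
    suff -> : G m.+1 x - G m x = s by rewrite mulVf ?gt_eqF//; lra.
    by rewrite /G mS minD_eq// -mS.
have key m : I (G m.+1) <= s + l (G m).
  elim: m => [|m IH].
    apply: (@le_trans _ _ s).
      rewrite -[leRHS](mint_cst (dT := dT) rmeasure s).
      apply: mint_le => //; first exact: mcontinuous_cst.
      by move=> x; rewrite /G mul1r ge_min lexx orbT.
    by rewrite lerDl l0.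
  have -> : I (G m.+2) = I (G m.+1) + I (fun x => G m.+2 x - G m.+1 x).
    rewrite -mintD//; congr (Rintegral _ _ _); apply/funext => x.
    by rewrite addrC subrK.
  have -> : l (G m.+1) = l (G m) + l (fun x => G m.+1 x - G m x).
    by rewrite -lD//; congr l; apply/funext => x; rewrite addrC subrK.
  by have := step m; lra.
pose m := (Num.truncn s^-1).+1.
have Gg k : (m <= k)%N -> G k = g.
  move=> mk; apply/funext => x; apply/min_idPl.
  have /andP[_ /le_trans] := g01 x; apply.
  rewrite -ler_pdivrMr// div1r; apply: ltW.
  by apply: (lt_le_trans (truncnS_gt _)); rewrite ler_nat.
by have := key m; rewrite !Gg// addrC.
Qed.

Let mint_le_functional g : mcontinuous dT g -> I g <= l g.
Proof.
move=> gc; have [C C0 gC] := mcontinuous_bounded cT gc.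
have Cc := mcontinuous_cst dT C.
have onec := mcontinuous_cst dT (1 : R).
pose h x := (2 * C)^-1 * (g x + C * 1).
have onec' := mcontinuousZ C onec.
have gDc : mcontinuous dT (fun x => g x + C * 1) by exact: mcontinuousD.
have hc : mcontinuous dT h by exact: mcontinuousZ.
have C20 : 0 < 2 * C by lra.
have : I h <= l h.
  apply: mint_le_functional01 => // x.
  have := gC x; rewrite ler_norml => /andP[? ?].
  rewrite /h ler_pdivrMl//; apply/andP; split; last lra.
  by apply: mulr_ge0; [rewrite invr_ge0 ltW|lra].
rewrite mintZ// lZ// ler_pM2l ?invr_gt0// mintD// lD// mintZ// lZ//.
by rewrite mint_cst l1 lerD2r.
Qed.

Theorem riesz_representation :
  exists P : probability (g_sigma_algebraType (mopen dT)) R,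
    forall g : T -> R, mcontinuous dT g ->
      Rintegral P setT (g : g_sigma_algebraType (mopen dT) -> R) = l g.
Proof.
exists rmeasure => g gc; apply/eqP; rewrite eq_le mint_le_functional//=.
(* The one-sided bound applied to [- g] is the reverse inequality for [g]. *)
have gNc := mcontinuousZ (-1) gc.
have := mint_le_functional gNc.
by rewrite mintZ// lZ// !mulN1r lerN2.
Qed.

End Riesz.

(** * Positive operators on a compact metric space *)

Section FamilySup.
Variables (R : realType) (I : pointedType).
Implicit Types a b : I -> R.

(** The index type is pointed, so the range is nonempty and an upper bound is all that [sup]
    requires. *)
Definition fsup a : R := sup (range a).

Lemma fsup_ge a C i : (forall i, a i <= C) -> a i <= fsup a.
Proof. by move=> aC; apply: ub_le_sup; [exists C => _ [j _ <-]|exists i]. Qed.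

Lemma fsup_le a C : (forall i, a i <= C) -> fsup a <= C.
Proof. by move=> aC; apply: ge_sup; [exists (a point); exists point|move=> _ [j _ <-]]. Qed.

Lemma fsup_adherent a C (e : R) : (forall i, a i <= C) -> 0 < e ->
  exists i, fsup a < a i + e.
Proof.
move=> aC e0; have [] := @sup_adherent _ (range a) e e0.
  by split; [exists (a point); exists point|exists C => _ [j _ <-]].
by move=> _ [i _ <-] ?; exists i; rewrite /fsup; lra.
Qed.

Lemma fsup_dist a b C (e : R) : (forall i, a i <= C) -> (forall i, b i <= C) ->
  (forall i, `|a i - b i| <= e) -> `|fsup a - fsup b| <= e.
Proof.
move=> aC bC ab.
have : fsup a <= fsup b + e.
  apply: fsup_le => i; have := ab i; rewrite ler_norml => /andP[_ ?].
  by have := fsup_ge i bC; lra.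
have : fsup b <= fsup a + e.
  apply: fsup_le => i; have := ab i; rewrite ler_norml => /andP[? _].
  by have := fsup_ge i aC; lra.
by move=> ? ?; rewrite ler_norml; apply/andP; split; lra.
Qed.

End FamilySup.

(** * A fixed function from the upper limit of the iterates of 1 *)

Section Operator.
Variables (R : realType) (X : pointedType) (rho : X -> X -> R).
Hypotheses (dm : is_metric rho) (cX : compact_ind rho).
Variable T : (X -> R) -> (X -> R).
Hypothesis Tc : forall g, mcontinuous rho g -> mcontinuous rho (T g).
Hypothesis TD : forall g h, mcontinuous rho g -> mcontinuous rho h ->
  T (fun x => g x + h x) = (fun x => T g x + T h x).
Hypothesis TZ : forall (c : R) g, mcontinuous rho g ->
  T (fun x => c * g x) = (fun x => c * T g x).
Hypothesis Tle : forall g h, mcontinuous rho g -> mcontinuous rho h ->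
  (forall x, g x <= h x) -> forall x, T g x <= T h x.
Implicit Types (g h : X -> R) (n : nat).

Let onec : mcontinuous rho (fun=> 1 : R). Proof. exact: mcontinuous_cst. Qed.

Lemma iterTc n g : mcontinuous rho g -> mcontinuous rho (iter n T g).
Proof. by move=> gc; elim: n => // n IH; exact: Tc. Qed.

Lemma iterTD n g h : mcontinuous rho g -> mcontinuous rho h ->
  iter n T (fun x => g x + h x) = (fun x => iter n T g x + iter n T h x).
Proof. by move=> gc hc; elim: n => //= n ->; rewrite TD//; exact: iterTc. Qed.

Lemma iterTZ n (c : R) g : mcontinuous rho g ->
  iter n T (fun x => c * g x) = (fun x => c * iter n T g x).
Proof. by move=> gc; elim: n => //= n ->; rewrite TZ//; exact: iterTc. Qed.

Lemma iterTB n g h : mcontinuous rho g -> mcontinuous rho h ->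
  iter n T (fun x => g x - h x) = (fun x => iter n T g x - iter n T h x).
Proof.
move=> gc hc; have -> : (fun x => g x - h x) = fun x => g x + (-1) * h x.
  by apply/funext => x; rewrite mulN1r.
rewrite iterTD// ?iterTZ//; last exact: mcontinuousZ.
by apply/funext => x; rewrite mulN1r.
Qed.

Lemma iterTle n g h : mcontinuous rho g -> mcontinuous rho h ->
  (forall x, g x <= h x) -> forall x, iter n T g x <= iter n T h x.
Proof.
move=> gc hc gh; elim: n => //= n IH x.
by apply: Tle => //; exact: iterTc.
Qed.

Lemma iterT_cst n (c : R) : iter n T (fun=> c) = (fun x => c * iter n T (fun=> 1) x).
Proof. by rewrite -iterTZ//; congr (iter n T _); apply/funext => x; rewrite mulr1. Qed.

Variable K : R.
Hypothesis K0 : 0 < K.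
Hypothesis u_bound : forall n x, K^-1 <= iter n T (fun=> 1) x <= K.
Hypothesis equi : forall g, mcontinuous rho g -> forall e : R, 0 < e ->
  exists2 r : R, 0 < r &
    forall x y, rho x y < r -> forall n, `|iter n T g x - iter n T g y| <= e.

Lemma iterT_bounded g : mcontinuous rho g ->
  exists2 C : R, 0 < C & forall n x, `|iter n T g x| <= C.
Proof.
move=> gc; have [C C0 gC] := mcontinuous_bounded cX gc.
exists (C * K); first by rewrite mulr_gt0.
have uK n x : iter n T (fun=> 1) x <= K by case/andP: (u_bound n x).
move=> n x; rewrite ler_norml; apply/andP; split.
  apply: (@le_trans _ _ (iter n T (fun=> - C) x)).
    by rewrite iterT_cst mulNr lerN2 ler_pM2l.
  apply: iterTle => //; first exact: mcontinuous_cst.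
  by move=> y; have := gC y; rewrite ler_norml => /andP[].
apply: (@le_trans _ _ (iter n T (fun=> C) x)).
  apply: iterTle => //; first exact: mcontinuous_cst.
  by move=> y; have := gC y; rewrite ler_norml => /andP[].
by rewrite iterT_cst ler_pM2l.
Qed.

(** [K] bounds [T 1]; this carries the uniform approximations given by Dini's theorem through one
    application of [T]. *)
Lemma T_shift_le g h (e : R) : mcontinuous rho g -> mcontinuous rho h -> 0 <= e ->
  (forall x, g x <= h x + e) -> forall x, T g x <= T h x + e * K.
Proof.
move=> gc hc e0 gh x.
have ec := mcontinuous_cst rho e.
apply: (@le_trans _ _ (T (fun x => h x + e) x)).
  by apply: Tle => //; exact: mcontinuousD.
rewrite TD// lerD2l -/(iter 1 T (fun=> e) x) iterT_cst ler_wpM2l//.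
by case/andP: (u_bound 1 x).
Qed.

Let u n := iter n T (fun=> 1).

Let uc n : mcontinuous rho (u n). Proof. exact: iterTc. Qed.

Let u_le n x : u n x <= K. Proof. by case/andP: (u_bound n x). Qed.
Let u_ge n x : K^-1 <= u n x. Proof. by case/andP: (u_bound n x). Qed.

Let w k x := fsup (fun n => u (n + k) x).

Let w_ge k n x : u (n + k) x <= w k x.
Proof. exact: (@fsup_ge _ _ (fun n => u (n + k) x) K). Qed.

Let w_lb k x : K^-1 <= w k x.
Proof. exact: le_trans (u_ge _ _) (w_ge k 0 x). Qed.

Let w_equi (e : R) : 0 < e -> exists2 r : R, 0 < r &
  forall x y, rho x y < r -> forall k, `|w k x - w k y| <= e.
Proof.
move=> e0; have [r r0 ur] := equi onec e0; exists r => // x y xy k.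
by apply: (@fsup_dist _ _ _ _ K) => // n; exact: ur.
Qed.

Let wc k : mcontinuous rho (w k).
Proof.
move=> x e e0; have [|r r0 wr] := @w_equi (e / 2); first lra.
by exists r => // y xy; apply: le_lt_trans (wr x y xy k) _; lra.
Qed.

Let w_ni k x : w k.+1 x <= w k x.
Proof. by apply: fsup_le => n; rewrite addnS -addSn; exact: w_ge. Qed.

Let Tw k x : w k.+1 x <= T (w k) x.
Proof.
apply: fsup_le => n; rewrite addnS.
by apply: (Tle (uc (n + k)) (wc k)) => y; exact: w_ge.
Qed.

(** The infimum over [k] of the tail suprema [w k] is taken as the negative of a supremum, so that
    the facts on [fsup] apply again. *)
Let wN x := fsup (fun k => - w k x).

Let wN_ge k x : - w k x <= wN x.
Proof.
apply: (@fsup_ge _ _ (fun k => - w k x) 0) => i.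
by rewrite oppr_le0 (le_trans _ (w_lb i x))// invr_ge0 ltW.
Qed.

Let winf x := - wN x.

Let winf_le k x : winf x <= w k x.
Proof. by rewrite /winf lerNl wN_ge. Qed.

Let winf_lb x : K^-1 <= winf x.
Proof. by rewrite /winf lerNr; apply: fsup_le => k; rewrite lerN2 w_lb. Qed.

Let winfc : mcontinuous rho winf.
Proof.
move=> x e e0; have [|r r0 wr] := @w_equi (e / 2); first lra.
exists r => // y xy; rewrite /winf -opprD normrN.
apply: (@le_lt_trans _ _ (e / 2)); last lra.
have wle z i : - w i z <= 0 by rewrite oppr_le0 (le_trans _ (w_lb i z))// invr_ge0 ltW.
apply: (@fsup_dist _ _ _ _ 0) => // k.
by rewrite -opprD normrN wr.
Qed.

Let Twinf x : winf x <= T winf x.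
Proof.
apply/ler_addgt0Pr => e e0.
have eK0 : 0 < e / K by rewrite divr_gt0.
have wNc k : mcontinuous rho (fun x => -1 * w k x) by exact: mcontinuousZ.
have nwc : mcontinuous rho (fun x => -1 * winf x) by exact: mcontinuousZ.
have [] := dini cX nwc wNc _ _ eK0.
- by move=> y n; rewrite !mulN1r lerN2.
- move=> y e' e'0.
  have wle i : - w i y <= 0 by rewrite oppr_le0 (le_trans _ (w_lb i y))// invr_ge0 ltW.
  have [k ?] := fsup_adherent wle e'0.
  by exists k; rewrite !mulN1r /winf opprK.
move=> k wk; apply: (le_trans (winf_le k.+1 x)).
apply: (le_trans (Tw k x)).
have -> : e = e / K * K by rewrite divfK// gt_eqF.
apply: T_shift_le => //; first exact: ltW.
by move=> y; have := wk y; rewrite !mulN1r; lra.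
Qed.

(* The upper limit of T^n 1 is a subsolution, so its iterates increase; their
   supremum is fixed, since by Dini both limits are uniform. *)
Lemma exists_fixed_function : exists h, [/\ mcontinuous rho h,
  forall x, 0 < h x & T h = h].
Proof.
pose v n := iter n T winf.
have vc n : mcontinuous rho (v n) by exact: iterTc.
have vnd x n : v n x <= v n.+1 x.
  by rewrite /v iterSr; apply: iterTle => //; exact: Tc.
have [C C0 vC'] := iterT_bounded winfc.
have vC x n : v n x <= C by apply: le_trans (ler_norm _) (vC' n x).
pose h x := fsup (fun n => v n x).
have h_ge n x : v n x <= h x by apply: (@fsup_ge _ _ (fun n => v n x) C).
have hc : mcontinuous rho h.
  move=> x e e0; have e20 : 0 < e / 2 by lra.
  have [r r0 vr] := equi winfc e20; exists r => // y xy.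
  apply: (@le_lt_trans _ _ (e / 2)); last lra.
  by apply: (@fsup_dist _ _ _ _ C) => // n; exact: vr.
exists h; split=> //.
  move=> x; apply: lt_le_trans (h_ge 0%N x).
  by apply: lt_le_trans (winf_lb x); rewrite invr_gt0.
apply/funext => x; apply/eqP; rewrite eq_le; apply/andP; split.
  apply/ler_addgt0Pr => e e0.
  have eK0 : 0 < e / K by rewrite divr_gt0.
  have [] := dini cX hc vc vnd _ eK0.
    by move=> y e' e'0; exact: fsup_adherent (vC y) e'0.
  move=> n hn; apply: (@le_trans _ _ (v n.+1 x + e)); last by rewrite lerD2r.
  have -> : e = e / K * K by rewrite divfK// gt_eqF.
  apply: T_shift_le => //; first exact: ltW.
  by move=> y; apply: ltW.
apply: fsup_le => n; apply: (le_trans (vnd x n)).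
exact: Tle.
Qed.

(** [k] and [c] depend on the radius alone: the same gain is available around every centre and at
    every stage of the iteration. *)
Hypothesis doeblin : forall r : R, 0 < r -> exists k (c : R), 0 < c /\
  forall (y : X) g (t : R), mcontinuous rho g -> (forall x, 0 <= g x) -> 0 <= t ->
    (forall z, rho y z < r -> t <= g z) -> forall x, t * c <= iter k T g x.

Definition perron_frobenius (h : X -> R)
    (P : probability (g_sigma_algebraType (mopen rho)) R) :=
  [/\ mcontinuous rho h /\ (forall x, 0 < h x),
      T h = h,
      forall g, mcontinuous rho g -> Rintegral P setT (T g) = Rintegral P setT g,
      forall g, mcontinuous rho g -> forall e : R, 0 < e ->
        exists N, forall n, (N <= n)%N -> forall x,
          `|iter n T g x - h x * Rintegral P setT g| <= e &
      forall P' : probability (g_sigma_algebraType (mopen rho)) R,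
        (forall g, mcontinuous rho g ->
          Rintegral P' setT (T g) = Rintegral P' setT g) ->
        forall A : set (g_sigma_algebraType (mopen rho)),
          measurable A -> P' A = P A].

(** * Convergence of the iterates and the invariant probability *)

Section FixedFunction.
Variable h : X -> R.
Hypotheses (hc : mcontinuous rho h) (h_gt0 : forall x, 0 < h x) (Th : T h = h).

Let iterTh n : iter n T h = h. Proof. by elim: n => //= n ->. Qed.

Let h_bounds : exists lo hi : R, [/\ 0 < lo, 0 < hi & forall x, lo <= h x <= hi].
Proof.
have [C C0 hC] := mcontinuous_bounded cX hc.
have [D D0 hD] : exists2 D : R, 0 < D & forall x, `|(h x)^-1| <= D.
  apply: (mcontinuous_bounded cX); apply/mcontinuousP => x.
  apply: cvgV; first by rewrite gt_eqF.
  by move/mcontinuousP: hc; exact.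
exists D^-1, C; split=> //; first by rewrite invr_gt0.
move=> x; apply/andP; split; last exact: le_trans (ler_norm _) (hC x).
rewrite -[leRHS]invrK lef_pV2 ?posrE ?invr_gt0//.
exact: le_trans (ler_norm _) (hD x).
Qed.

Let conv g (l : R) := forall e : R, 0 < e ->
  exists N, forall n, (N <= n)%N -> forall x, `|iter n T g x - l * h x| <= e.

(** As [h] is fixed, [T] preserves inequalities [m h <= g <= M h]. The supremum of [T^n g / h] thus
    decreases and its infimum increases, and only the closing of the gap needs the minorization. *)
Lemma ratio_converges g : mcontinuous rho g -> exists l : R, conv g l.
Proof.
move=> gc; have [lo [hi [lo0 hi0 hb]]] := h_bounds.
have hl x : lo <= h x by case/andP: (hb x).
have hu x : h x <= hi by case/andP: (hb x).
have [C C0 gC] := iterT_bounded gc.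
pose q n x := iter n T g x / h x.
have qC n x : `|q n x| <= C / lo.
  rewrite normrM; apply: ler_pM => //.
  by rewrite normfV gtr0_norm// lef_pV2 ?posrE.
have qN n x : - q n x <= C / lo.
  by apply: le_trans (qC n x); rewrite -normrN ler_norm.
have qP n x : q n x <= C / lo by apply: le_trans (qC n x); rewrite ler_norm.
pose Mx n := fsup (q n). pose mi n := - fsup (fun x => - q n x).
have qM n x : q n x <= Mx n by exact: fsup_ge (qP n).
have mq n x : mi n <= q n x.
  by rewrite /mi lerNl; apply: (@fsup_ge _ _ (fun x => - q n x) (C / lo)).
have gE n x : iter n T g x = q n x * h x by rewrite /q divfK// gt_eqF.
have Mhc c : mcontinuous rho (fun x => c * h x) by exact: mcontinuousZ.
have gMk n k x : iter (k + n) T g x <= Mx n * h x.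
  rewrite iterD; apply: (@le_trans _ _ (iter k T (fun x => Mx n * h x) x)).
    apply: iterTle => //; first exact: iterTc.
    by move=> y; rewrite gE ler_pM2r.
  by rewrite iterTZ// iterTh.
have mgk n k x : mi n * h x <= iter (k + n) T g x.
  rewrite iterD; apply: (@le_trans _ _ (iter k T (fun x => mi n * h x) x)).
    by rewrite iterTZ// iterTh.
  apply: iterTle => //; first exact: iterTc.
  by move=> y; rewrite gE ler_pM2r.
have qMk n k x : q (k + n)%N x <= Mx n by rewrite ler_pdivrMr.
have mqk n k x : mi n <= q (k + n)%N x by rewrite ler_pdivlMr.
have Mk n k : Mx (k + n)%N <= Mx n by apply: fsup_le.
have mM n k : mi n <= Mx (k + n)%N.
  exact: le_trans (mqk n k point) (qM _ _).
have osc (e : R) : 0 < e -> exists n, Mx n - mi n <= e.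
  move=> e0; apply: contrapT => /forallNP H.
  have {}H n : e < Mx n - mi n by rewrite ltNge; apply/negP; exact: H.
  (* At a near-minimizer of the ratio, [psi] below is at least [3/4 lo e]; moving within the ball
     loses at most [t / 4] through [T^n g] and [t / 4] through [h], which leaves [t]. *)
  pose t := lo * e / 2; have t0 : 0 < t by rewrite /t !mulr_gt0// invr_gt0.
  have Ch0 : 0 < C / lo by rewrite divr_gt0.
  have t40 : 0 < t / 4 by lra.
  have t4C : 0 < t / 4 / (C / lo) by rewrite divr_gt0.
  have [r1 r10 gr] := equi gc t40.
  have [r2 r20 hr] := mcontinuous_unif dm cX hc t4C.
  have r0 : 0 < Num.min r1 r2 by rewrite lt_min r10.
  have [k [c [c0 Hk]]] := doeblin r0.
  have MxC n : `|Mx n| <= C / lo.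
    rewrite ler_norml; apply/andP; split; last exact: fsup_le.
    apply: le_trans (qM n point).
    by have := qC n point; rewrite ler_norml => /andP[].
  have drop n : Mx (k + n)%N <= Mx n - t * c / hi.
    pose psi x := Mx n * h x - iter n T g x.
    have psic : mcontinuous rho psi by apply: mcontinuousB => //; exact: iterTc.
    have psi0 x : 0 <= psi x by rewrite subr_ge0; exact: (gMk n 0).
    have e40 : 0 < e / 4 by lra.
    have [y] := fsup_adherent (qN n) e40.
    rewrite -/(- - fsup _) => qy.
    have {}qy : q n y < mi n + e / 4 by rewrite /mi; lra.
    have psiy : lo * (e * 3 / 4) <= psi y.
      have := H n => Hn; rewrite /psi gE -mulrBl [leRHS]mulrC.
      by apply: ler_pM => //; [exact: ltW|lra|lra].
    have psit z : rho y z < Num.min r1 r2 -> t <= psi z.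
      rewrite lt_min => /andP[/gr/(_ n) yz /hr/ltW hyz].
      have : `|Mx n * (h y - h z)| <= t / 4.
        rewrite normrM; apply: (@le_trans _ _ (C / lo * (t / 4 / (C / lo)))).
          exact: ler_pM.
        by rewrite mulrCA divff ?mulr1// gt_eqF.
      move: yz psiy; rewrite /psi /t !ler_norml => /andP[? ?] ? /andP[? ?]; lra.
    have Tpsi x : t * c <= iter k T psi x by apply: Hk psit x => //; exact: ltW.
    apply: fsup_le => x; rewrite ler_pdivrMr//.
    have := Tpsi x; rewrite iterTB//; last exact: iterTc.
    rewrite iterTZ// iterTh -iterD => Tx.
    have : t * c / hi * h x <= t * c.
      have tc0 : 0 < t * c by rewrite mulr_gt0.
      by rewrite mulrAC ler_pdivrMr// ler_pM2l.
    by rewrite mulrBl; lra.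
  have dropj j : Mx (j * k)%N <= Mx 0%N - j%:R * (t * c / hi).
    elim: j => [|j IH]; first by rewrite mul0n mul0r subr0.
    by rewrite mulSn -natr1; have := drop (j * k)%N; lra.
  have s0 : 0 < t * c / hi by rewrite divr_gt0// mulr_gt0.
  (* Enough drops to push the supremum below the initial infimum, which [mM] forbids. *)
  pose j := (Num.truncn ((Mx 0%N - mi 0%N) / (t * c / hi))).+1.
  have : (Mx 0%N - mi 0%N) / (t * c / hi) < j%:R by exact: truncnS_gt.
  rewrite ltr_pdivrMr// => jl.
  have := mM 0%N (j * k)%N; rewrite addn0; have := dropj j; lra.
pose l := - fsup (fun n => - Mx n).
have Mn0 n : - Mx n <= - mi 0%N.
  by rewrite lerN2; have := mM 0%N n; rewrite addn0.
have lM n : l <= Mx n by rewrite /l lerNl; exact: fsup_ge (Mn0).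
have ml n : mi n <= l.
  rewrite /l lerNr; apply: fsup_le => j; rewrite lerN2.
  have := Mk j n; have := mM n j; rewrite addnC; lra.
exists l => e e0.
have [|N HN] := osc (e / hi); first by rewrite divr_gt0.
exists N => n /subnK <- x.
have := qMk N (n - N)%N x; have := mqk N (n - N)%N x.
have := lM N; have := ml N => ? ? ? ?.
rewrite gE -mulrBl normrM (gtr0_norm (h_gt0 x)).
have : `|q (n - N + N)%N x - l| <= e / hi.
  by rewrite ler_norml; apply/andP; split; lra.
move=> /(ler_pM (normr_ge0 _) (ltW (h_gt0 x))) /(_ (hu x)) /le_trans; apply.
by rewrite divfK// gt_eqF.
Qed.

Let conv_unique g l l' : conv g l -> conv g l' -> l = l'.
Proof.
move=> gl gl'; apply/eqP; rewrite -subr_eq0 -normr_le0.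
rewrite -(pmulr_lle0 _ (h_gt0 point)) -{1}(gtr0_norm (h_gt0 point)) -normrM.
apply/ler_addgt0Pr => e e0; rewrite add0r.
have [|N HN] := gl (e / 2); first lra.
have [|N' HN'] := gl' (e / 2); first lra.
have := HN _ (leq_maxl N N') point; have := HN' _ (leq_maxr N N') point.
by rewrite !ler_norml => /andP[? ?] /andP[? ?]; apply/andP; split; lra.
Qed.

Let convD g g' l l' : mcontinuous rho g -> mcontinuous rho g' ->
  conv g l -> conv g' l' -> conv (fun x => g x + g' x) (l + l').
Proof.
move=> gc gc' gl gl' e e0.
have [|N HN] := gl (e / 2); first lra.
have [|N' HN'] := gl' (e / 2); first lra.
exists (maxn N N') => n; rewrite geq_max => /andP[Nn N'n] x.
have := HN n Nn x; have := HN' n N'n x; rewrite iterTD// !ler_norml.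
by move=> /andP[? ?] /andP[? ?]; apply/andP; split; lra.
Qed.

Let convZ g (c l : R) : mcontinuous rho g -> conv g l -> conv (fun x => c * g x) (c * l).
Proof.
move=> gc gl e e0; have c0 : 0 < `|c| + 1 by rewrite ltr_wpDl.
have [|N HN] := gl (e / (`|c| + 1)); first by rewrite divr_gt0.
exists N => n /HN {}HN x; rewrite iterTZ// -mulrA -mulrBr normrM.
apply: (@le_trans _ _ ((`|c| + 1) * (e / (`|c| + 1)))).
  by apply: ler_pM => //; rewrite lerDl.
by rewrite mulrCA divff ?mulr1// gt_eqF.
Qed.

Let convT g l : conv g l -> conv (T g) l.
Proof.
by move=> gl e /gl[N HN]; exists N => n Nn x; rewrite -iterSr HN// leqW.
Qed.

Let conv_ge g l (c : R) : conv g l -> (forall n x, c <= iter n T g x) ->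
  c <= l * h point.
Proof.
move=> gl gc; apply/ler_addgt0Pr => e /gl[N /(_ _ (leqnn N) point)].
by rewrite ler_norml => /andP[_]; have := gc N point; lra.
Qed.

Lemma fixed_functional :
  exists (hh : X -> R) (P : probability (g_sigma_algebraType (mopen rho)) R),
    perron_frobenius hh P.
Proof.
(* [lf] is total, with the default 0 at discontinuous functions, where nothing is claimed. *)
have /choice[lf Hlf] : forall g, exists l, mcontinuous rho g -> conv g l.
  move=> g; have [gc|ngc] := pselect (mcontinuous rho g); last by exists 0.
  by have [l gl] := ratio_converges gc; exists l.
pose a := lf (fun=> 1).
have a0 : 0 < a.
  have := conv_ge (Hlf _ onec) (fun n x => u_ge n x).
  by rewrite -ler_pdivrMr//; apply: lt_le_trans; rewrite divr_gt0// invr_gt0.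
(* Dividing by the value at 1 makes the functional a probability; [h] is multiplied by the same [a],
   so the limits [hh * lr g] stay unchanged. *)
pose lr g := lf g / a.
have lrD g g' : mcontinuous rho g -> mcontinuous rho g' ->
    lr (fun x => g x + g' x) = lr g + lr g'.
  move=> gc gc'; rewrite /lr -mulrDl; congr (_ / _).
  apply: conv_unique (Hlf _ (mcontinuousD gc gc')) _.
  by apply: convD => //; exact: Hlf.
have lrZ (c : R) g : mcontinuous rho g -> lr (fun x => c * g x) = c * lr g.
  move=> gc; rewrite /lr mulrA; congr (_ / _).
  by apply: conv_unique (Hlf _ (mcontinuousZ c gc)) _; apply: convZ => //; exact: Hlf.
have lr0 g : mcontinuous rho g -> (forall x, 0 <= g x) -> 0 <= lr g.
  move=> gc g0; rewrite /lr divr_ge0 ?(ltW a0)//.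
  rewrite -(pmulr_lge0 _ (h_gt0 point)).
  apply: (conv_ge (Hlf _ gc)) => n x.
  have -> : 0 = iter n T (fun=> 0) x by rewrite iterT_cst mul0r.
  by apply: iterTle => //; exact: mcontinuous_cst.
have lr1 : lr (fun=> 1) = 1 by rewrite /lr divff// gt_eqF.
have [P HP] := riesz_representation dm cX lrD lrZ lr0 lr1.
pose hh x := a * h x.
have hhc : mcontinuous rho hh by exact: mcontinuousZ.
have Hconv g : mcontinuous rho g -> forall e : R, 0 < e ->
    exists N, forall n, (N <= n)%N -> forall x, `|iter n T g x - hh x * lr g| <= e.
  move=> gc e /(Hlf g gc)[N HN]; exists N => n /HN {}HN x.
  have -> : hh x * lr g = lf g * h x; last exact: HN.
  by rewrite /hh /lr mulrC mulrA divfK// gt_eqF.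
exists hh, P; split.
- by split=> // x; rewrite mulr_gt0.
- by rewrite /hh TZ// Th.
- move=> g gc; rewrite !HP//; last exact: Tc.
  rewrite /lr; congr (_ / _); apply: conv_unique (Hlf _ (Tc gc)) _.
  by apply: convT; exact: Hlf.
- by move=> g gc; rewrite HP//; exact: Hconv.
- move=> P' HP'.
  have inv n g : mcontinuous rho g ->
      Rintegral P' setT (iter n T g) = Rintegral P' setT g.
    by move=> gc; elim: n => //= n IH; rewrite HP'//; exact: iterTc.
  (* Invariance equates the integral of [g] with that of [T^N g], which is uniformly close to
     [hh * lr g]. Taking [g = 1] then gives [hh] integral 1. *)
  have key g : mcontinuous rho g ->
      Rintegral P' setT g = Rintegral P' setT hh * lr g.
    move=> gc; apply/eqP; rewrite -subr_eq0 -normr_le0.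
    apply/ler_addgt0Pr => e e0; rewrite add0r.
    have [N /(_ _ (leqnn N)) HN] := Hconv g gc e e0.
    rewrite -(inv N g gc) mulrC -(mintZ cX)//.
    apply: (mint_dist cX) => //; [exact: iterTc|exact: mcontinuousZ|].
    by move=> x; rewrite [X in _ - X]mulrC.
  have hh1 : Rintegral P' setT hh = 1.
    by have := key _ onec; rewrite lr1 mulr1 mint_cst.
  apply: (mint_unique dm cX) => g gc.
  by rewrite key// hh1 mul1r HP.
Qed.

End FixedFunction.

Theorem ruelle_perron_frobenius_operator :
  exists (h : X -> R) (P : probability (g_sigma_algebraType (mopen rho)) R),
    perron_frobenius h P.
Proof. by have [h [hc h0 Th]] := exists_fixed_function; exact: (fixed_functional hc h0 Th). Qed.

End Operator.

(** * The Ruelle operator *)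

Lemma quasi_additive (R : realType) (b : nat -> R) (D : R) :
  (forall n m, `|b (n + m)%N - b n - b m| <= D) ->
  exists L : R, forall n, `|b n - n%:R * L| <= D.
Proof.
move=> bD; have D0 : 0 <= D by exact: le_trans (bD 0%N 0%N).
have bD1 n m : b (n + m)%N <= b n + b m + D.
  by have := bD n m; rewrite ler_norml => /andP[? ?]; lra.
have bD2 n m : b n + b m - D <= b (n + m)%N.
  by have := bD n m; rewrite ler_norml => /andP[? ?]; lra.
have up m n : b (m.+1 * n)%N + D <= m.+1%:R * (b n + D).
  elim: m => [|m IH]; first by rewrite mul1n mul1r.
  by rewrite mulSn -[m.+2%:R]natr1; have := bD1 n (m.+1 * n)%N; lra.
have dn m n : m.+1%:R * (b n - D) <= b (m.+1 * n)%N - D.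
  elim: m => [|m IH]; first by rewrite mul1n mul1r.
  by rewrite mulSn -[m.+2%:R]natr1; have := bD2 n (m.+1 * n)%N; lra.
(* Both quotients are compared with [b] at the product of the two indices. Any number separating the
   two families is a valid slope, and the supremum of the lower one is taken. *)
have cross n m : (b n.+1 - D) / n.+1%:R <= (b m.+1 + D) / m.+1%:R.
  rewrite ler_pdivrMr// mulrAC ler_pdivlMr// mulrC [leRHS]mulrC.
  have := dn m n.+1; have := up n m.+1; rewrite mulnC; lra.
exists (fsup (fun n => (b n.+1 - D) / n.+1%:R)) => -[|n].
  by rewrite mul0r subr0; have := bD 0%N 0%N; rewrite addn0 subrr sub0r normrN.
set L := fsup _.
have L1 : (b n.+1 - D) / n.+1%:R <= L.
  exact: (@fsup_ge _ _ (fun n => (b n.+1 - D) / n.+1%:R) _ n (fun i => cross i 0%N)).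
have L2 : L <= (b n.+1 + D) / n.+1%:R by exact: fsup_le.
move: L1 L2; rewrite ler_pdivrMr// ler_pdivlMr// => ? ?.
by rewrite ler_norml; apply/andP; split; lra.
Qed.

(** * Inverse branches, distortion and growth of the iterates *)

Section Ruelle.
Variables (R : realType) (M : pointedType) (d : M -> M -> R).
Variable mu : probability (g_sigma_algebraType (mopen d)) R.
Variable f : (nat -> M) -> R.
Hypotheses (dm : is_metric d) (cM : compact_ind d).
Hypothesis mu_supp : forall U : set M, mopen d U -> U !=set0 -> (0 < mu U)%E.
Hypothesis fc : mcontinuous (dOmega d) f.
Hypothesis fw : weak_walters d f.
Implicit Types (x y z w : nat -> M) (a : M) (g h : (nat -> M) -> R).

Local Notation O := (dOmega d).
Local Notation L := (ruelle mu f).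

Let om : is_metric O := dOmega_metric dm cM.
Let oc : compact_ind O := Omega_compact_ind dm cM.

Let efc g : mcontinuous O g -> mcontinuous O (fun x => expR (f x) * g x).
Proof.
by move=> gc; apply: mcontinuousM => //; apply: mcontinuous_comp => //; exact: continuous_expR.
Qed.

Let Lac g x : mcontinuous O g ->
  mcontinuous d (fun a => expR (f (pcons a x)) * g (pcons a x)).
Proof. by move=> gc; exact: (mcontinuous_pcons dm cM x (efc gc)). Qed.

Lemma ruelle_continuous g : mcontinuous O g -> mcontinuous O (L g).
Proof.
move=> gc x e e0; have e20 : 0 < e / 2 by lra.
have [r r0 gr] := mcontinuous_unif om oc (efc gc) e20.
have [_ deq _ _] := dm.
exists r => // y xy; apply: (@le_lt_trans _ _ (e / 2)); last lra.
apply: (mint_dist cM); [exact: Lac|exact: Lac|] => a.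
apply/ltW/gr; rewrite dOmega_pcons// (deq _ _).2//.
by have := dOmega_ge0 dm cM x y; lra.
Qed.

Lemma ruelleD g h : mcontinuous O g -> mcontinuous O h ->
  L (fun x => g x + h x) = (fun x => L g x + L h x).
Proof.
move=> gc hc; apply/funext => x; rewrite /ruelle -(mintD cM)//; [|exact: Lac|exact: Lac].
by congr (Rintegral _ _ _); apply/funext => a; rewrite mulrDr.
Qed.

Lemma ruelleZ (c : R) g : mcontinuous O g ->
  L (fun x => c * g x) = (fun x => c * L g x).
Proof.
move=> gc; apply/funext => x; rewrite /ruelle -(mintZ cM)//; last exact: Lac.
by congr (Rintegral _ _ _); apply/funext => a; rewrite mulrCA.
Qed.

Lemma ruelle_le g h : mcontinuous O g -> mcontinuous O h ->
  (forall x, g x <= h x) -> forall x, L g x <= L h x.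
Proof.
move=> gc hc gh x; apply: (mint_le cM); [exact: Lac|exact: Lac|] => a.
by rewrite ler_wpM2l// expR_ge0.
Qed.

Let Lnc n g : mcontinuous O g -> mcontinuous O (iter n L g).
Proof. exact: (iterTc ruelle_continuous). Qed.

(* Compares L^n g at x with L^n h at y inverse branch by inverse branch; the
   constants absorb the weights of the symbols already prepended. *)
Lemma iter_ruelle_le n (c c' : R) x y g h :
  mcontinuous O g -> mcontinuous O h ->
  (forall w, c * (expR (Ssum f n (pword n w x)) * g (pword n w x)) <=
             c' * (expR (Ssum f n (pword n w y)) * h (pword n w y))) ->
  c * iter n L g x <= c' * iter n L h y.
Proof.
move=> gc hc; elim: n c c' x y => [|n IH] c c' x y H.
  have := H point; rewrite /Ssum !big_ord0 expR0 !mul1r.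
  have pw z : pword 0 point z = z by apply/funext => k; rewrite /pword subn0.
  by rewrite !pw.
rewrite !iterS /ruelle -!(mintZ cM); try by apply: Lac; exact: Lnc.
apply: (mint_le cM); try by apply: mcontinuousZ; apply: Lac; exact: Lnc.
move=> a; rewrite !mulrA; apply: IH => w.
have := H (fun k => if (k < n)%N then w k else a).
rewrite -!pword_rcons !SsumS !expRD.
set A := expR (Ssum _ _ _). set B := expR (Ssum _ _ _).
set A' := expR (f _). set B' := expR (f _).
by rewrite -!mulrA ![A' * (A * _)]mulrCA ![B' * (B * _)]mulrCA.
Qed.

(** [Cf] ranges over nonempty words; the empty word is added here, its Birkhoff sum being 0. *)
Lemma weak_walters_Ssum (e : R) : 0 < e -> exists2 r : R, 0 < r &
  forall x y, O x y < r -> forall n w,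
    Ssum f n (pword n w x) <= Ssum f n (pword n w y) + e.
Proof.
move=> e0; have [r r0 H] := fw e0; exists r => // x y /H Cxy -[|n] w.
  by rewrite /Ssum !big_ord0 add0r ltW.
rewrite -lerBlDl -lee_fin; apply: le_trans (ltW Cxy).
by apply: le_trans (lee_abs _); apply: ereal_sup_ubound; exists n.+1, w.
Qed.

Let fbound : exists2 B : R, 0 < B & forall x, `|f x| <= B.
Proof. by have [B B0 fB] := mcontinuous_bounded oc fc; exists B. Qed.

Lemma pword_cat m n w x :
  pword (m + n) w x = pword m w (pword n (fun k => w (m + k)%N) x).
Proof.
apply/funext => k; rewrite /pword; case: ltnP => mk.
  case: ltnP => [//|km]; rewrite ltn_subLR// mk.
  by rewrite subnKC.
have km := leq_trans (leq_addr n m) mk.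
by rewrite ltnNge km /= ltnNge leq_subRL// mk subnDA.
Qed.

(* Prepending N common symbols brings any two points together, so the weak
   Walters condition controls all but the last N terms of the Birkhoff sums. *)
Lemma bounded_distortion : exists2 D : R, 0 < D & forall x y n w,
  Ssum f n (pword n w x) <= Ssum f n (pword n w y) + D.
Proof.
have [B B0 fB] := fbound; have [C C0 dC] := metric_bounded om oc.
have [r r0 H] := weak_walters_Ssum ltr01.
have [N NC] := exists_geometric_lt C r0.
have sB n z : `|Ssum f n z| <= n%:R * B.
  rewrite /Ssum; elim: n => [|n IH]; first by rewrite big_ord0 normr0 mul0r.
  rewrite big_ord_recr /= -natr1 mulrDl mul1r.
  by apply: le_trans (ler_normD _ _) _; exact: lerD.
have NB : 0 <= N%:R * B by rewrite mulr_ge0// ltW.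
(* The 1 is the weak Walters bound for the leading terms; each [N * B] bounds the last [N] terms at
   one of the two points. *)
exists (1 + N%:R * B + N%:R * B); first lra.
move=> x y n w; have [nN|Nn] := leqP n N.
  have nB : n%:R * B <= N%:R * B by rewrite ler_pM2r// ler_nat.
  have := sB n (pword n w x); have := sB n (pword n w y).
  by rewrite !ler_norml => /andP[? ?] /andP[? ?]; lra.
rewrite -(subnK (ltnW Nn)); set m := (n - N)%N; rewrite !pword_cat.
have SD z : Ssum f (m + N) z = Ssum f m z + Ssum f N (iter m (@Defs.shift M) z).
  rewrite /Ssum big_split_ord /=; congr (_ + _).
  by apply: eq_bigr => i _; rewrite addnC iterD.
rewrite !SD !iter_shift_pword; set v := fun k => _.
have : O (pword N v x) (pword N v y) < r.
  rewrite dOmega_pword//; apply: le_lt_trans NC.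
  by rewrite ler_wpM2l// exprn_ge0//; lra.
move=> /H /(_ m w); have := sB N (pword N v x); have := sB N (pword N v y).
by rewrite !ler_norml => /andP[? ?] /andP[? ?]; lra.
Qed.

Let onec : mcontinuous O (fun=> 1 : R). Proof. exact: mcontinuous_cst. Qed.

(** The bound [1 <= g] turns the additive modulus of [g] into a multiplicative one, which combines
    with the distortion of the weights branch by branch. *)
Lemma iter_ruelle_near g : mcontinuous O g -> (forall x, 1 <= g x) ->
  forall e : R, 0 < e -> exists2 r : R, 0 < r &
    forall x y, O x y < r -> forall n, iter n L g x <= expR e * iter n L g y.
Proof.
move=> gc g1 e e0; have e20 : 0 < e / 2 by lra.
have [r r0 H] := weak_walters_Ssum e20.
have [s s0 gs] := mcontinuous_unif om oc gc e20.
exists (Num.min r s); first by rewrite lt_min r0.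
move=> x y; rewrite lt_min => /andP[xyr xys] n.
rewrite -[leLHS]mul1r; apply: iter_ruelle_le => // w; rewrite mul1r.
have -> : e = e / 2 + e / 2 by lra.
rewrite expRD mulrACA; apply: ler_pM; rewrite ?expR_ge0//.
- by apply: le_trans (g1 _).
- by rewrite -expRD ler_expR addrC H.
- have : `|g (pword n w x) - g (pword n w y)| < e / 2.
    by apply: gs; apply: le_lt_trans xys; exact: dOmega_pword_le.
  rewrite ltr_norml => /andP[_ ?].
  have := g1 (pword n w y) => ?.
  apply: (@le_trans _ _ ((1 + e / 2) * g (pword n w y))); first by nra.
  by rewrite ler_wpM2r ?expR_ge1Dx//; lra.
Qed.

Let U n := iter n L (fun=> 1).

(** The induction carries a lower bound uniform in [x], because integrals are compared with
    constants. *)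
Let U_gt0 n x : 0 < U n x.
Proof.
have [B B0 fB] := fbound.
suff [c c0 H] : exists2 c : R, 0 < c & forall x, c <= U n x by exact: lt_le_trans (H x).
elim: n {x} => [|n [c c0 IH]]; first by exists 1.
exists (expR (- B) * c); first by rewrite mulr_gt0// expR_gt0.
move=> x; rewrite -[leLHS](mint_cst (dT := d) mu).
apply: (mint_le cM); [exact: mcontinuous_cst|by apply: Lac; exact: Lnc|] => a.
apply: ler_pM; [exact: expR_ge0|exact: ltW| |exact: IH].
by rewrite ler_expR; have := fB (pcons a x); rewrite ler_norml => /andP[].
Qed.

Lemma iter_ruelle_growth : exists lam K : R, [/\ 0 < lam, 0 < K &
  forall n x, K^-1 <= lam ^- n * iter n L (fun=> 1) x <= K].
Proof.
have [D D0 HD] := bounded_distortion.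
have UD n x y : U n x <= expR D * U n y.
  rewrite -[leLHS]mul1r; apply: iter_ruelle_le => // w.
  by rewrite mul1r !mulr1 -expRD ler_expR addrC.
pose p : nat -> M := point.
have UE n m : U (n + m)%N = iter n L (U m) by rewrite /U iterD.
have UDp n m : U (n + m)%N p <= expR D * (U n p * U m p).
  rewrite UE.
  (* Distortion replaces the inner iterate by a constant multiple of its value at [p], which
     linearity pulls out of the outer iterates. *)
  apply: (@le_trans _ _ (iter n L (fun=> expR D * U m p) p)).
    apply: (iterTle ruelle_continuous ruelle_le) => //; first exact: Lnc.
    exact: mcontinuous_cst.
  by rewrite (iterT_cst ruelle_continuous ruelleZ) -/(U n p) -mulrA [U m p * _]mulrC.
have UDm n m : expR (- D) * (U n p * U m p) <= U (n + m)%N p.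
  rewrite UE.
  apply: (@le_trans _ _ (iter n L (fun=> expR (- D) * U m p) p)).
    by rewrite (iterT_cst ruelle_continuous ruelleZ) -/(U n p) -mulrA [U m p * _]mulrC.
  apply: (iterTle ruelle_continuous ruelle_le) => //.
  - exact: mcontinuous_cst.
  - exact: Lnc.
  - by move=> y; rewrite expRN ler_pdivrMl ?expR_gt0.
have [S HS] : exists S : R, forall n, `|ln (U n p) - n%:R * S| <= D.
  apply: quasi_additive => n m.
  have U2 : 0 < U n p * U m p by rewrite mulr_gt0.
  have := UDp n m; rewrite -ler_ln ?posrE ?mulr_gt0 ?expR_gt0//.
  have := UDm n m; rewrite -ler_ln ?posrE ?mulr_gt0 ?expR_gt0//.
  rewrite !(lnM (x := expR _)) ?posrE ?expR_gt0// !expRK lnM ?posrE// => ? ?.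
  by rewrite ler_norml; apply/andP; split; lra.
(* One [D] comes from moving [x] to [p], the other from the error of the slope [S]. *)
exists (expR S), (expR (D + D)); split; rewrite ?expR_gt0// => n x.
have -> : expR S ^- n = expR (- (n%:R * S)) by rewrite expRN expRM_natl.
have e2 : U n p = expR (ln (U n p)) by rewrite lnK// posrE.
have := HS n; rewrite ler_norml => /andP[H1 H2].
rewrite -expRN; apply/andP; split.
  rewrite -ler_pdivrMl ?expR_gt0// -expRN opprK -expRD.
  have : expR (- D) * U n p <= U n x by rewrite expRN ler_pdivrMl ?expR_gt0.
  apply: le_trans; rewrite e2 -expRD ler_expR; lra.
rewrite -ler_pdivlMl ?expR_gt0// -expRN opprK -expRD.
apply: (le_trans (UD n x p)); rewrite e2 -expRD ler_expR; lra.
Qed.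

(** * Equicontinuity and minorization for the normalized operator *)

Section Normalized.
Variables (lam K : R).
Hypotheses (lam0 : 0 < lam) (K0 : 0 < K).
Hypothesis growth : forall n x, K^-1 <= lam ^- n * iter n L (fun=> 1) x <= K.

Definition normalized_ruelle g x := lam^-1 * L g x.
Local Notation T := normalized_ruelle.

Lemma normalized_ruelle_continuous g : mcontinuous O g -> mcontinuous O (T g).
Proof. by move=> gc; apply: mcontinuousZ; exact: ruelle_continuous. Qed.

Lemma normalized_ruelleD g h : mcontinuous O g -> mcontinuous O h ->
  T (fun x => g x + h x) = (fun x => T g x + T h x).
Proof. by move=> gc hc; apply/funext => x; rewrite /T ruelleD// mulrDr. Qed.

Lemma normalized_ruelleZ (c : R) g : mcontinuous O g ->
  T (fun x => c * g x) = (fun x => c * T g x).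
Proof. by move=> gc; apply/funext => x; rewrite /T ruelleZ// mulrCA. Qed.

Lemma normalized_ruelle_le g h : mcontinuous O g -> mcontinuous O h ->
  (forall x, g x <= h x) -> forall x, T g x <= T h x.
Proof.
by move=> gc hc gh x; rewrite ler_wpM2l ?invr_ge0 ?(ltW lam0)//; exact: ruelle_le.
Qed.

Let Tc := normalized_ruelle_continuous.
Let TD := normalized_ruelleD.
Let TZ := normalized_ruelleZ.
Let Tle := normalized_ruelle_le.

Lemma iter_normalized_ruelle n g : mcontinuous O g ->
  iter n T g = (fun x => lam ^- n * iter n L g x).
Proof.
move=> gc; elim: n => [|n IH]; first by apply/funext => x; rewrite expr0 invr1 mul1r.
rewrite iterS IH /T ruelleZ; last exact: Lnc.
by apply/funext => x; rewrite exprS invfM mulrA.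
Qed.

Lemma normalized_ruelle_bound n x : K^-1 <= iter n T (fun=> 1) x <= K.
Proof. by rewrite iter_normalized_ruelle. Qed.

Let equi1 g : mcontinuous O g -> (forall x, 1 <= g x) ->
  forall e : R, 0 < e -> exists2 r : R, 0 < r &
    forall x y, O x y < r -> forall n, `|iter n T g x - iter n T g y| <= e.
Proof.
move=> gc g1 e e0.
have [C C0 TC] := iterT_bounded oc Tc TZ Tle K0 normalized_ruelle_bound gc.
have eC0 : 0 < e / C by rewrite divr_gt0.
(* With iterates bounded by [C], a relative error [e / C] is an absolute error [e]. *)
have [|r r0 H] := iter_ruelle_near gc g1 (e := ln (1 + e / C)).
  by rewrite ln_gt0// ltrDl.
rewrite lnK ?posrE in H; last lra.
have one x y n : O x y < r -> iter n T g x - iter n T g y <= e.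
  move=> /H /(_ n) Hn.
  have : iter n T g x <= (1 + e / C) * iter n T g y.
    rewrite iter_normalized_ruelle// mulrCA ler_wpM2l//.
    by rewrite invr_ge0 exprn_ge0// ltW.
  have : e / C * iter n T g y <= e.
    have -> : e = e / C * C by rewrite divfK// gt_eqF.
    by rewrite mulfK ?gt_eqF// ler_pM2l//; exact: le_trans (ler_norm _) (TC n y).
  by lra.
have [_ _ os _] := om.
exists r => // x y xy n; rewrite ler_norml; apply/andP; split; last exact: one.
by rewrite lerNl opprB; apply: one; rewrite os.
Qed.

Lemma normalized_ruelle_equi g : mcontinuous O g ->
  forall e : R, 0 < e -> exists2 r : R, 0 < r &
    forall x y, O x y < r -> forall n, `|iter n T g x - iter n T g y| <= e.
Proof.
move=> gc e e0; have [C C0 gC] := mcontinuous_bounded oc gc.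
have Cc : mcontinuous O (fun=> C + 1) by exact: mcontinuous_cst.
(* Adding [C + 1] brings [g] above 1; the iterates of this constant are equicontinuous too and are
   subtracted afterwards. *)
have gCc : mcontinuous O (fun x => g x + (C + 1)) by exact: mcontinuousD.
have e20 : 0 < e / 2 by lra.
have [|r r0 Hr] := equi1 gCc _ e20.
  by move=> x; have := gC x; rewrite ler_norml => /andP[? _]; lra.
have [|s s0 Hs] := equi1 Cc _ e20; first by move=> _; lra.
exists (Num.min r s); first by rewrite lt_min r0.
move=> x y; rewrite lt_min => /andP[/Hr + /Hs +] n => /(_ n) + /(_ n).
rewrite (iterTD Tc TD)// !ler_norml => /andP[? ?] /andP[? ?].
by apply/andP; split; lra.
Qed.

(** Full support makes each ball charged; compactness makes the bound uniform, since the ball of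
    radius [s / 2] at [a] lies in the ball of radius [s] at every [b] closer than [s / 2] to [a]. *)
Let ball_mass (s : R) : 0 < s -> exists2 c : R, 0 < c &
  forall a, c <= fine (mu (mball d a s)).
Proof.
move=> s0; have [_ _ ds tri] := dm.
have mb a r := mopen_measurable (@mball_open _ _ d a r dm).
have [] : exists2 c : R, 0 < c & forall a, [set: M] a -> c <= fine (mu (mball d a s)).
  apply: (cM (Q := fun A => exists2 c : R, 0 < c &
    forall a, A a -> c <= fine (mu (mball d a s)))).
  - by exists 1.
  - by move=> A B AB [c c0 H]; exists c => // a /AB /H.
  - move=> A B [c c0 H] [c' c'0 H']; exists (Num.min c c'); first by rewrite lt_min c0.
    by move=> a [/H|/H'] Ha; rewrite ge_min Ha ?orbT.
  - move=> a; have s20 : 0 < s / 2 by lra.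
    exists (s / 2) => //; exists (fine (mu (mball d a (s / 2)))).
      have : (0 < mu (mball d a (s / 2)))%E.
        apply: mu_supp; first exact: mball_open.
        by exists a; exact: mball_center.
      by move=> mu0; apply: fine_gt0; rewrite mu0 -ge0_fin_numE// fin_num_measure.
    move=> b ab; apply: fine_le; rewrite ?fin_num_measure//.
    apply: le_measure; rewrite ?inE//.
    move=> z; rewrite /mball /= => az; rewrite /mball /= in ab.
    by have := tri b a z; rewrite (ds b a); lra.
by move=> c c0 H; exists c => // a; exact: H.
Qed.

(* Each application of T frees one coordinate, at the cost of the mass of a
   ball of radius s around the corresponding coordinate of y. *)
Lemma normalized_ruelle_doeblin (r : R) : 0 < r -> exists k (c : R), 0 < c /\
  forall y g (t : R), mcontinuous O g -> (forall x, 0 <= g x) -> 0 <= t ->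
    (forall z, O y z < r -> t <= g z) -> forall x, t * c <= iter k T g x.
Proof.
move=> r0; have [C C0 dC] := metric_bounded dm cM.
have s0 : 0 < r / 4 by lra.
have [k kr] := exists_geometric_lt C s0.
have [c0 c00 Hc] := ball_mass s0.
have [B B0 fB] := fbound.
(* Price of one freed coordinate: normalization, least weight of a branch, least mass of a ball. *)
pose c := lam^-1 * (expR (- B) * c0).
have cp : 0 < c by rewrite !mulr_gt0 ?invr_gt0 ?expR_gt0.
exists k, (c ^+ k); split; first exact: exprn_gt0.
have main j y g (t : R) : mcontinuous O g -> (forall x, 0 <= g x) -> 0 <= t ->
    (forall z, cyl d y j (r / 4) z -> t <= g z) -> forall x, t * c ^+ j <= iter j T g x.
  elim: j y g t => [|j IH] y g t gc g0 t0 H x.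
    by rewrite expr0 mulr1; apply: H.
  rewrite iterSr exprS mulrA; apply: (IH (Defs.shift y)).
  - exact: Tc.
  - move=> z; rewrite /T mulr_ge0 ?invr_ge0 ?(ltW lam0)//.
    by apply: Rintegral_ge0 => a _; rewrite mulr_ge0// expR_ge0.
  - by rewrite mulr_ge0// ltW.
  - move=> z Hz; rewrite /T /c mulrCA ler_wpM2l ?invr_ge0 ?(ltW lam0)//.
    apply: (@le_trans _ _ (expR (- B) * t * fine (mu (mball d (y 0%N) (r / 4))))).
      rewrite mulrA [t * _]mulrC ler_wpM2l// mulr_ge0// expR_ge0//.
    apply: (mint_ge cM); first exact: Lac.
    + exact: mball_open.
    + by rewrite mulr_ge0// expR_ge0.
    + by move=> a; rewrite mulr_ge0// expR_ge0.
    + move=> a ya; apply: ler_pM; [exact: expR_ge0|exact: t0| |].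
        by rewrite ler_expR; have := fB (pcons a z); rewrite ler_norml => /andP[].
      by apply: H => -[|i] //= ij; exact: Hz.
move=> y g t gc g0 t0 H; apply: (main k y) => // z Hz; apply: H.
(* The [k] controlled coordinates and the tail contribute at most [r / 4] each, so the cylinder lies
   in the ball of radius [r]. *)
apply: le_lt_trans (_ : r / 4 + (1 / 2) ^+ k * C < _); last lra.
apply: (dOmega_cyl dm cM) => //; first exact: ltW.
by move=> i ik; apply/ltW/Hz.
Qed.

End Normalized.

End Ruelle.

Theorem mainTheorem9 (R : realType) (M : pointedType) (d : M -> M -> R)
  (mu : probability (g_sigma_algebraType (mopen d)) R)
  (f : (nat -> M) -> R) :
  is_metric d ->
  mcompact d ->
  (forall U : set M, mopen d U -> U !=set0 -> (0 < mu U)%E) ->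
  mcontinuous (dOmega d) f ->
  weak_walters d f ->
  exists (lam : R) (h : (nat -> M) -> R)
         (nu : probability (g_sigma_algebraType (mopen (dOmega d))) R),
    [/\ 0 < lam,
        mcontinuous (dOmega d) h /\ (forall x, 0 < h x),
        (forall x, ruelle mu f h x = lam * h x) /\
        (forall phi : (nat -> M) -> R, mcontinuous (dOmega d) phi ->
           Rintegral nu setT (ruelle mu f phi) = lam * Rintegral nu setT phi),
        (forall phi : (nat -> M) -> R, mcontinuous (dOmega d) phi ->
           forall e : R, 0 < e -> \forall n \near \oo,
             (sup_norm (fun x => (lam ^- n * iter n (ruelle mu f) phi x
                                 - h x * Rintegral nu setT phi)%R) <= e%:E)%E) &
        (forall nu' : probability (g_sigma_algebraType (mopen (dOmega d))) R,
           (forall phi : (nat -> M) -> R, mcontinuous (dOmega d) phi ->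
              Rintegral nu' setT (ruelle mu f phi) = lam * Rintegral nu' setT phi) ->
           forall A : set (g_sigma_algebraType (mopen (dOmega d))),
             measurable A -> nu' A = nu A)].
Proof.
move=> dm cM' mu_supp fc fw; have cM := mcompact_compact_ind dm cM'.
have om := dOmega_metric dm cM; have oc := Omega_compact_ind dm cM.
have [lam [K [lam0 K0 growth]]] := iter_ruelle_growth mu dm cM fc fw.
have lamN : lam != 0 by rewrite gt_eqF.
have [h [nu [hc Th Tnu cvg uni]]] := ruelle_perron_frobenius_operator om oc
  (normalized_ruelle_continuous mu dm cM fc lam) (normalized_ruelleD mu dm cM fc lam)
  (normalized_ruelleZ mu dm cM fc lam) (normalized_ruelle_le mu dm cM fc lam0) K0
  (normalized_ruelle_bound dm cM fc growth) (normalized_ruelle_equi dm cM fc fw lam0 K0 growth)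
  (normalized_ruelle_doeblin dm cM mu_supp fc lam0).
exists lam, h, nu; split=> //.
- split=> [x|g gc].
    by rewrite -{2}Th /normalized_ruelle mulVKf.
  rewrite -(Tnu g gc) (mintZ oc); last exact: (ruelle_continuous mu dm cM fc).
  by rewrite mulVKf.
- move=> g gc e e0; have [N HN] := cvg g gc e e0; exists N => // n Nn.
  apply: ge_ereal_sup => _ [x _ <-]; rewrite lee_fin.
  by have := HN n Nn x; rewrite (iter_normalized_ruelle mu dm cM fc lam n gc).
- move=> nu' Hnu'; apply: uni => g gc.
  rewrite (mintZ oc); last exact: (ruelle_continuous mu dm cM fc).
  by rewrite Hnu'// mulKf.
Qed.
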